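(* Let $(M^{2n},\omega)$ be a symplectic manifold and $E\to M$ a vector bundle with a symplectically flat connection with curvature $F=\Phi\,\omega$. Then every point of $M$ has an open neighborhood $U$ with a trivialization (local frame) of $E|_U$ with respect to which $\Phi$ is represented by a constant matrix and the covariant derivative is $d+\Phi\lambda$ for some $1$-form $\lambda\in\Omega^1(U)$ satisfying $d\lambda=\omega$.
   Context: For a connection on $E$ with covariant derivative $d_A$ (locally $d+A\wedge$) and curvature $F\in\Omega^2(M,\mathrm{End}\,E)$, the connection is called symplectically flat if there is $\Phi\in\Omega^0(M,\mathrm{End}\,E)$ with $F=\Phi\,\omega$ and $d_A\Phi=d\Phi+[A,\Phi]=0$. *)

(* Defs.v *)
From HB Require Import structures.
From mathcomp Require Import all_boot all_order all_algebra all_field.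
From mathcomp Require Import all_classical all_reals all_analysis.

Set Implicit Arguments.
Unset Strict Implicit.
Unset Printing Implicit Defensive.

Import GRing.Theory Num.Theory numFieldNormedType.Exports.
Local Open Scope classical_set_scope.
Local Open Scope ring_scope.

(* Meant for open U: only the values of f near the points of U matter. *)
Fixpoint Ck (R : realType) (V W : normedModType R) (k : nat) (U : set V)
    (f : V -> W) : Prop :=
  match k with
  | 0 => forall x, U x -> {for x, continuous f}
  | k'.+1 => (forall x, U x -> differentiable f x) /\
             (forall v : V, Ck k' U (fun x => 'D_v f x))
  end.

Definition smooth (R : realType) (V W : normedModType R) (U : set V)
    (f : V -> W) : Prop := forall k, Ck k U f.

(* Manifolds have no boundary, are Hausdorff and second countable. The maps   *)
(* chart i and chart_inv i are total; they are meaningful only on chart_dom i *)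
(* and on its image, respectively. The atlas need not be maximal.             *)
Record manifold (R : realType) (d : nat) := Manifold {
  carrier :> topologicalType;
  carrier_hausdorff : hausdorff_space carrier;
  carrier_second_countable : @second_countable carrier;
  atlas : Type;
  chart_dom : atlas -> set carrier;
  chart : atlas -> carrier -> 'rV[R]_d;
  chart_inv : atlas -> 'rV[R]_d -> carrier;
  chart_dom_open : forall i, open (chart_dom i);
  chart_dom_cover : forall x, exists i, chart_dom i x;
  chart_image_open : forall i, open (chart i @` chart_dom i);
  chartK : forall i x, chart_dom i x -> chart_inv i (chart i x) = x;
  chart_continuous : forall i x, chart_dom i x -> {for x, continuous (chart i)};
  chart_inv_continuous : forall i x, chart_dom i x ->
    {for chart i x, continuous (chart_inv i)};
  chart_smooth : forall i j,
    smooth (chart i @` (chart_dom i `&` chart_dom j))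
           (fun y => chart j (chart_inv i y))
}.

(* Functions with values in a finite-dimensional real vector space V are      *)
(* differentiated in coordinates: v2r : V -> 'rV_(dim V) is a linear          *)
(* isomorphism with inverse r2v.                                              *)
Definition smooth_fun (R : realType) (d : nat) (M : manifold R d)
    (V : vectType R) (U : set M) (f : M -> V) : Prop :=
  forall i : atlas M,
    smooth (chart i @` (U `&` chart_dom i))
           (fun y => VectorInternalTheory.v2r (f (chart_inv i y))).

(* The partial derivative of f at x in the coordinate mu of the chart i. *)
Definition pderiv (R : realType) (d : nat) (M : manifold R d)
    (V : vectType R) (i : atlas M) (mu : 'I_d) (f : M -> V) (x : M) : V :=
  VectorInternalTheory.r2v
    ('D_(delta_mx 0 mu)
       (fun y => VectorInternalTheory.v2r (f (chart_inv i y))) (chart i x)).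

(* d chart_j^nu / d chart_i^mu *)
Definition jacobian (R : realType) (d : nat) (M : manifold R d)
    (i j : atlas M) (mu nu : 'I_d) (x : M) : R :=
  pderiv (V := R^o) i mu (fun y => chart j y 0 nu) x.

(* Forms are given by their components in the charts: a i mu x is the         *)
(* coefficient of dx^mu at x in the chart i, and w i mu nu x is the value of  *)
(* w on (d/dx^mu, d/dx^nu). Components at points outside chart_dom i are junk. *)
Definition components1 (R : realType) (d : nat) (M : manifold R d) :=
  atlas M -> 'I_d -> M -> R^o.

Definition components2 (R : realType) (d : nat) (M : manifold R d) :=
  atlas M -> 'I_d -> 'I_d -> M -> R^o.

Definition form1 (R : realType) (d : nat) (M : manifold R d) (U : set M)
    (a : components1 M) : Prop :=
  (forall i mu, smooth_fun (U `&` chart_dom i) (a i mu)) /\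
  (forall i j mu x, U x -> chart_dom i x -> chart_dom j x ->
     a i mu x = \sum_(nu < d) jacobian i j mu nu x * a j nu x).

Definition form2 (R : realType) (d : nat) (M : manifold R d) (U : set M)
    (w : components2 M) : Prop :=
  [/\ forall i mu nu, smooth_fun (U `&` chart_dom i) (w i mu nu),
      forall i mu nu x, U x -> chart_dom i x -> w i mu nu x = - w i nu mu x &
      forall i j mu nu x, U x -> chart_dom i x -> chart_dom j x ->
        w i mu nu x = \sum_(rho < d) \sum_(sigma < d)
          jacobian i j mu rho x * jacobian i j nu sigma x * w j rho sigma x].

Definition ext_deriv1 (R : realType) (d : nat) (M : manifold R d)
    (a : components1 M) : components2 M :=
  fun i mu nu x => pderiv i mu (a i nu) x - pderiv i nu (a i mu) x.

Definition ext_deriv2 (R : realType) (d : nat) (M : manifold R d)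
    (w : components2 M) (i : atlas M) (mu nu rho : 'I_d) (x : M) : R^o :=
  pderiv i mu (w i nu rho) x + pderiv i nu (w i rho mu) x
    + pderiv i rho (w i mu nu) x.

Definition symplectic (R : realType) (d : nat) (M : manifold R d)
    (w : components2 M) : Prop :=
  [/\ form2 setT w,
      forall i mu nu rho x, chart_dom i x -> ext_deriv2 w i mu nu rho x = 0 &
      forall i x, chart_dom i x -> forall v : 'rV[R]_d,
        (forall u : 'rV[R]_d,
           \sum_(mu < d) \sum_(nu < d) v 0 mu * u 0 nu * w i mu nu x = 0) ->
        v = 0].

(* K is a finite field extension of R, i.e. the real or the complex numbers:  *)
(* real and complex vector bundles are treated together. The smooth structure *)
(* is given by an atlas of local frames.                                      *)
Record bundle (R : realType) (K : fieldExtType R) (d : nat) (M : manifold R d)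
    (r : nat) := Bundle {
  fiber :> M -> vectType K;
  triv_atlas : Type;
  triv_dom : triv_atlas -> set M;
  triv : triv_atlas -> 'I_r -> forall x : M, fiber x;
  triv_dom_open : forall a, open (triv_dom a);
  triv_dom_cover : forall x, exists a, triv_dom a x;
  triv_basis : forall a x, triv_dom a x ->
    basis_of fullv [tuple triv a k x | k < r];
  triv_smooth : forall a b k l,
    smooth_fun (V := K) (triv_dom a `&` triv_dom b)
      (fun x => coord [tuple triv a m x | m < r] l (triv b k x))
}.

Section Bundles.
Variables (R : realType) (K : fieldExtType R) (d : nat) (M : manifold R d).
Variables (r : nat) (E : bundle K M r).

(* Local sections over U are represented by total functions, whose values     *)
(* outside U are junk.                                                        *)
Definition section := forall x : M, E x.

Definition smooth_section (U : set M) (s : section) : Prop :=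
  forall (a : triv_atlas E) (l : 'I_r),
    smooth_fun (V := K) (U `&` triv_dom a)
      (fun x => coord [tuple triv a m x | m < r] l (s x)).

Definition local_frame (U : set M) (e : 'I_r -> section) : Prop :=
  (forall k, smooth_section U (e k)) /\
  (forall x, U x -> basis_of fullv [tuple e k x | k < r]).

Definition section_components1 := atlas M -> 'I_d -> section.

Definition section_components2 := atlas M -> 'I_d -> 'I_d -> section.

Definition section_form1 (U : set M) (t : section_components1) : Prop :=
  (forall i mu, smooth_section (U `&` chart_dom i) (t i mu)) /\
  (forall i j mu x, U x -> chart_dom i x -> chart_dom j x ->
     t i mu x = \sum_(nu < d) ((jacobian i j mu nu x)%:A : K) *: t j nu x).

(* A connection acts on smooth sections over all open sets, compatibly with   *)
(* restriction; its value near a point where s is not smooth is junk.         *)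
Record connection := Connection {
  nabla :> section -> section_components1;
  nabla_form1 : forall (U : set M) (s : section),
    open U -> smooth_section U s -> section_form1 U (nabla s);
  nabla_local : forall (U : set M) (s t : section),
    open U -> smooth_section U s -> (forall x, U x -> s x = t x) ->
    forall i mu x, U x -> chart_dom i x -> nabla s i mu x = nabla t i mu x;
  nablaD : forall (U : set M) (s t : section),
    open U -> smooth_section U s -> smooth_section U t ->
    forall i mu x, U x -> chart_dom i x ->
    nabla (fun y => s y + t y) i mu x = nabla s i mu x + nabla t i mu x;
  nabla_leibniz : forall (U : set M) (f : M -> K) (s : section),
    open U -> smooth_fun U f -> smooth_section U s ->
    forall i mu x, U x -> chart_dom i x ->
    nabla (fun y => f y *: s y) i mu x =
      pderiv i mu f x *: s x + f x *: nabla s i mu x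
}.

(* The exterior covariant derivative d_A on E-valued 1-forms. *)
Definition nabla1 (D : connection) (t : section_components1) :
    section_components2 :=
  fun i mu nu x => D (t i nu) i mu x - D (t i mu) i nu x.

(* F = d_A d_A, which is dA + A /\ A in a local frame. *)
Definition curvature (D : connection) (s : section) : section_components2 :=
  nabla1 D (D s).

Definition endomorphism := forall x : M, 'End(E x).

Definition smooth_endomorphism (Phi : endomorphism) : Prop :=
  forall (a : triv_atlas E) (k : 'I_r),
    smooth_section (triv_dom a) (fun x => Phi x (triv a k x)).

(* The connection induced on End E, which is d Phi + [A, Phi] in a local      *)
(* frame: (d_A Phi) s = d_A (Phi s) - Phi (d_A s).                            *)
Definition nabla_end (D : connection) (Phi : endomorphism) (s : section) :
    section_components1 :=
  fun i mu x => D (fun y => Phi y (s y)) i mu x - Phi x (D s i mu x).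

Definition symplectically_flat (w : components2 M) (D : connection)
    (Phi : endomorphism) : Prop :=
  [/\ smooth_endomorphism Phi,
      forall (U : set M) (s : section), open U -> smooth_section U s ->
        forall i mu nu x, U x -> chart_dom i x ->
        curvature D s i mu nu x = ((w i mu nu x)%:A : K) *: Phi x (s x) &
      forall (U : set M) (s : section), open U -> smooth_section U s ->
        forall i mu x, U x -> chart_dom i x -> nabla_end D Phi s i mu x = 0].

Definition represented_by (U : set M) (e : 'I_r -> section)
    (Phi : endomorphism) (C : 'M[K]_r) : Prop :=
  forall x, U x -> forall k, Phi x (e k x) = \sum_(l < r) C l k *: e l x.

(* In the frame e over U, the connection is d + C a: the section with         *)
(* coordinates f is sent to the one with coordinates df + a (C f).            *)
Definition nabla_in_frame (U : set M) (e : 'I_r -> section) (D : connection)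
    (C : 'M[K]_r) (a : components1 M) : Prop :=
  forall (V : set M) (f : 'I_r -> M -> K),
    open V -> V `<=` U -> (forall k, smooth_fun V (f k)) ->
    forall i mu x, V x -> chart_dom i x ->
    D (fun y => \sum_(k < r) f k y *: e k y) i mu x =
      \sum_(k < r)
        (pderiv i mu (f k) x + (a i mu x)%:A * \sum_(l < r) C k l * f l x)
          *: e k x.

End Bundles.

(* Main.v *)
Require Import Defs.
From HB Require Import structures.
From mathcomp Require Import all_boot all_order all_algebra all_field.
From mathcomp Require Import all_classical all_reals all_analysis.
From mathcomp Require Import perm ring lra.
Import Order.TTheory GRing.Theory Num.Theory numFieldNormedType.Exports.
Set Implicit Arguments.
Unset Strict Implicit.
Unset Printing Implicit Defensive.
Local Open Scope classical_set_scope.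
Local Open Scope ring_scope.
Import VectorInternalTheory.

(** On a coordinate ball let [l] be a primitive of the symplectic form, given by
    the Poincaré lemma, and let [A] be the connection form in some local frame.
    Since the curvature is [Phi omega] and [Phi] is parallel, the connection
    [d + A - l Phi] is flat. In a frame [g] of parallel sections of this flat
    connection the original one is [d + l Phi], and [Phi], being parallel for
    both connections, is represented by a constant matrix.

    The parallel frame solves [dg = - B g] with [B = A - l Phi]. On a small ball
    it is the limit of the Picard iterates of
    [g x = 1 - int_0^1 (B (t x) x) g (t x) dt]. Differentiating under the
    integral and integrating by parts in [t], flatness of [B] expresses the
    defect [dg_k + B g_k] of an iterate as a radial integral of the previous
    defect, up to the difference of two iterates, so the defects tend to 0
    geometrically. The limit is thus differentiable with [dg = - B g], and this
    equation makes it smooth. *)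

(** * Functions of class Ck *)

(** Integration along the rays from the centre of a ball, with a weight t^m, is the one analytic
    tool. Differentiation in x raises m by one, so the family of these integrals is closed under it;
    from it come the symmetry of second derivatives, the primitive [l] and the parallel frame.
    Solving along rays turns existence into a contraction on one ball. The price is that a radial
    solution a priori satisfies only the radial part of [dg = - B g]; the defects exist to control
    the other directions.

    Smoothness is defined by iterated directional derivatives, so equality of mixed partials has to
    be proved. It is needed because [lambda] is built in one chart and must satisfy
    [d lambda = omega] in all of them: the second derivatives of the transition maps have to cancel.

    Systems over [K] are solved as real systems of size r times dim K, so that only real integrals
    occur. *)

Section Differentials.
Context {R : realType}.
Implicit Types V W : normedModType R.

(** The limits and integrals below come with explicit estimates against a candidate differential;
    this form accepts such an estimate and returns the directional derivatives as well. *)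
Lemma differentiable_epsP V W (f : V -> W) (x : V) (L : {linear V -> W}) :
  continuous L ->
  (forall e, 0 < e -> \forall y \near x, `|f y - f x - L (y - x)| <= e * `|y - x|) ->
  differentiable f x /\ forall v, 'D_v f x = L v.
Proof.
move=> cL H.
have E : f \o shift x = cst (f x) + L +o_ (0 : V) id.
  apply/eqaddoP => e e0; have := H e e0.
  rewrite (near_shift 0 x) /=; apply: filterS => h /=.
  by rewrite subr0 addrK !fctE /= opprD addrA.
have U := diff_unique cL E.
have df : differentiable f x by apply/diff_locallyP; rewrite U.
by split=> // v; rewrite deriveE // U.
Qed.

Lemma differentiable_eps V W (f : V -> W) (x : V) : differentiable f x ->
  forall e, 0 < e ->
  \forall y \near x, `|f y - f x - 'd f x (y - x)| <= e * `|y - x|.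
Proof.
move=> df e e0; have /eqaddoP/(_ e e0) := diff_locally df.
move=> H; rewrite (near_shift 0 x) /=; apply: filterS H => y /=.
by rewrite subr0 addrK !fctE /= opprD addrA.
Qed.

Lemma near_eq_differentiable V W (f g : V -> W) (x : V) :
  (\near x, f x = g x) -> differentiable f x -> differentiable g x.
Proof.
move=> fg df; have := @differentiable_epsP _ _ g x ('d f x).
case=> //; first exact: diff_continuous.
move=> e e0; near=> y.
rewrite -(nbhs_singleton fg) -(_ : f y = g y); last by near: y.
by near: y; exact: differentiable_eps.
Unshelve. all: by end_near. Qed.

Lemma differentiable_mxP V m n (f : V -> 'M[R]_(m, n)) (x : V) :
  differentiable f x <->
  forall i j, differentiable (fun y => f y i j : R^o) x.
Proof.
split=> [df i j|df].
  have := differentiable_comp df (differentiable_coord (f x) i j).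
  exact.
have -> : f = \sum_(i < m) \sum_(j < n) (fun y => (f y i j : R) *: delta_mx i j).
  apply/funext => y; rewrite [LHS]matrix_sum_delta fct_sumE.
  by apply: eq_bigr => i _; rewrite fct_sumE.
apply: differentiable_sum => i; apply: differentiable_sum => j.
exact: differentiableZl.
Qed.

Lemma derive_mxE V m n (f : V -> 'M[R]_(m, n)) (x v : V) i j :
  differentiable f x -> ('D_v f x) i j = 'D_v (fun y => f y i j : R^o) x.
Proof.
by move=> df; rewrite derive_mx ?mxE //; apply: diff_derivable.
Qed.

Lemma derive_coord d W (f : 'rV[R]_d -> W) (x v : 'rV[R]_d) :
  differentiable f x ->
  'D_v f x = \sum_(j < d) v 0 j *: 'D_(delta_mx 0 j) f x.
Proof.
move=> df; rewrite deriveE // [v in LHS]row_sum_delta linear_sum.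
by apply: eq_bigr => j _; rewrite linearZ deriveE.
Qed.

Lemma derive_compE d V W (f : 'rV[R]_d -> W) (p : V -> 'rV[R]_d) (x v : V) :
  differentiable p x -> differentiable f (p x) ->
  'D_v (f \o p) x =
  \sum_(j < d) ('D_v p x) 0 j *: 'D_(delta_mx 0 j) f (p x).
Proof.
move=> dp df; rewrite deriveE; last exact: differentiable_comp.
by rewrite diff_comp //= -(deriveE v dp) -(deriveE _ df) derive_coord.
Qed.

End Differentials.

Section Ck.
Context {R : realType}.
Implicit Types V W : normedModType R.

Lemma Ck_subset V W k (U U' : set V) (f : V -> W) :
  U `<=` U' -> Ck k U' f -> Ck k U f.
Proof.
move=> UU'; elim: k f => [|k IH] f /= H; first by move=> x /UU'; exact: H.
by split=> [x /UU'|v]; [exact: H.1|exact: IH (H.2 v)].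
Qed.

Lemma Ck_eq V W k (U : set V) (f g : V -> W) :
  open U -> (forall x, U x -> f x = g x) -> Ck k U f -> Ck k U g.
Proof.
move=> oU; elim: k f g => [|k IH] f g fg /=.
  move=> cf x Ux; have fgx : \near x, f x = g x.
    by apply: filterS (open_nbhs_nbhs _) => [y|]; [exact: fg|split].
  rewrite /prop_for /continuous_at -(fg _ Ux).
  apply: cvg_trans (cf x Ux).
  exact: near_eq_cvg.
move=> [df ddf].
have nfg x : U x -> \near x, f x = g x.
  by move=> Ux; apply: filterS (open_nbhs_nbhs _) => [y|]; [exact: fg|split].
split=> [x Ux|v].
  by apply: near_eq_differentiable (df x Ux); exact: nfg.
by apply: IH (ddf v) => x Ux; apply: near_eq_derive; exact: nfg.
Qed.

Lemma Ck_leS V W k (U : set V) (f : V -> W) : Ck k.+1 U f -> Ck k U f.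
Proof.
elim: k f => [|k IH] f [df ddf].
  by move=> x Ux; apply: differentiable_continuous; exact: df.
by split=> // v; apply: IH; exact: ddf.
Qed.

Lemma Ck_continuous V W k (U : set V) (f : V -> W) : Ck k U f ->
  forall x, U x -> {for x, continuous f}.
Proof. by elim: k => // k IH /Ck_leS. Qed.

Lemma Ck_cst V W k (U : set V) (a : W) : Ck k U (fun=> a).
Proof.
elim: k a => [|k IH] a /=; first by move=> x _; exact: cvg_cst.
split=> [x _|v]; first exact: differentiable_cst.
have -> : 'D_v (fun=> a) = (fun=> 0) :> (V -> W) by apply/funext => x; exact: derive_cst.
exact: IH.
Qed.

Lemma CkD V W k (U : set V) (f g : V -> W) : open U ->
  Ck k U f -> Ck k U g -> Ck k U (fun x => f x + g x).
Proof.
move=> oU; elim: k f g => [|k IH] f g /=.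
  by move=> cf cg x Ux; apply: cvgD; [exact: cf|exact: cg].
move=> [df ddf] [dg ddg]; split=> [x Ux|v].
  by apply: differentiableD; [exact: df|exact: dg].
apply: Ck_eq (IH _ _ (ddf v) (ddg v)) => // x Ux.
rewrite -deriveD //; first exact/diff_derivable/df.
exact/diff_derivable/dg.
Qed.

Lemma Ck_sum V W k (U : set V) I (r : seq I) (P : pred I) (f : I -> V -> W) :
  open U -> (forall i, P i -> Ck k U (f i)) ->
  Ck k U (fun x => \sum_(i <- r | P i) f i x).
Proof.
move=> oU H.
rewrite (_ : (fun x => _) = \sum_(i <- r | P i) f i); last first.
  by apply/funext => x; rewrite fct_sumE.
elim/big_rec: _ => [|i g Pi]; first exact: Ck_cst.
by move=> Hg; apply: CkD => //; exact: H.
Qed.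

Lemma CkM V k (U : set V) (f g : V -> R^o) : open U ->
  Ck k U f -> Ck k U g -> Ck k U (fun x => f x * g x : R^o).
Proof.
move=> oU; elim: k f g => [|k IH] f g.
  by move=> cf cg x Ux; apply: cvgM; [exact: cf|exact: cg].
move=> Hf Hg; case: (Hf) (Hg) => [df ddf] [dg ddg]; split=> [x Ux|v].
  by apply: differentiableM; [exact: df|exact: dg].
apply: (@Ck_eq _ _ _ _ (fun x => f x * 'D_v g x + g x * 'D_v f x)) => //.
  move=> x Ux; apply/esym/deriveM; first exact/diff_derivable/df.
  exact/diff_derivable/dg.
by apply: CkD => //; apply: IH; first [exact: ddf|exact: ddg|exact: Ck_leS].
Qed.

Lemma CkZ V k (U : set V) (a : R) (f : V -> R^o) : open U ->
  Ck k U f -> Ck k U (fun x => a * f x : R^o).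
Proof. by move=> oU Hf; apply: CkM => //; exact: Ck_cst. Qed.

Lemma CkN V k (U : set V) (f : V -> R^o) : open U ->
  Ck k U f -> Ck k U (fun x => - f x : R^o).
Proof.
move=> oU Hf; apply: Ck_eq (CkZ (-1) oU Hf) => // x _.
exact: mulN1r.
Qed.

Lemma CkB V k (U : set V) (f g : V -> R^o) : open U ->
  Ck k U f -> Ck k U g -> Ck k U (fun x => f x - g x : R^o).
Proof. by move=> oU Hf Hg; apply: CkD => //; exact: CkN. Qed.

Lemma Ck_mxP V m n k (U : set V) (f : V -> 'M[R]_(m, n)) : open U ->
  Ck k U f <-> forall i j, Ck k U (fun y => f y i j : R^o).
Proof.
move=> oU; elim: k f => [|k IH] f /=.
  split=> [cf i j x Ux|cf x Ux].
    have := @continuous_comp _ _ _ f (fun M : 'M[R]_(m, n) => M i j : R^o) x (cf x Ux).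
    by apply; exact: coord_continuous.
  apply/cvgrPdist_le => /= e e0; near=> y.
  rewrite /Num.Def.normr /= mx_normrE (bigmax_le _ (ltW e0)) //= => i _.
  rewrite !mxE; move: i; near: y; apply: filter_forall => /= i.
  exact: ((cvgrPdist_le _ _).1 (cf i.1 i.2 x Ux)).
split=> [[df ddf] i j|H].
  split=> [x Ux|v]; first by move/differentiable_mxP: (df x Ux); exact.
  apply: Ck_eq ((IH _).1 (ddf v) i j) => // x Ux.
  by rewrite derive_mxE //; exact: df.
have df x : U x -> differentiable f x.
  by move=> Ux; apply/differentiable_mxP => i j; exact: (H i j).1.
split=> // v; apply/IH => i j.
apply: Ck_eq ((H i j).2 v) => // x Ux.
by rewrite derive_mxE //; exact: df.
Unshelve. all: by end_near. Qed.

(** Induction on [k]: by the chain rule a derivative of [f \o p] is a finite sum of products of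
    derivatives of [p] with partial derivatives of [f] composed with [p], and these have one order
    less. *)
Lemma Ck_comp d V k (U : set V) (U' : set 'rV[R]_d) (f : 'rV[R]_d -> R^o)
    (p : V -> 'rV[R]_d) : open U -> (forall x, U x -> U' (p x)) ->
  Ck k U p -> Ck k U' f -> Ck k U (f \o p).
Proof.
move=> oU UU'; elim: k f => [|k IH] f.
  move=> cp cf x Ux; apply: continuous_comp; first exact: cp.
  exact/cf/UU'.
move=> Hp [df ddf]; have [dp ddp] := Hp; split=> [x Ux|v].
  apply: differentiable_comp; first exact: dp.
  exact/df/UU'.
apply: (@Ck_eq _ _ _ _ (fun x => \sum_(j < d)
    ('D_v p x) 0 j * (('D_(delta_mx 0 j) f) \o p) x)) => //.
  by move=> x Ux; rewrite derive_compE //; [exact: dp|exact/df/UU'].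
apply: Ck_sum => // j _; apply: CkM => //.
  by move/Ck_mxP : (ddp v); exact.
by apply: IH; first [exact: ddf|exact: Ck_leS].
Qed.

Lemma Ck_coord d k (U : set 'rV[R]_d) j : Ck k U (fun x => x 0 j : R^o).
Proof.
case: k => [x _|k] ; first exact: coord_continuous.
split=> [x _|v]; first exact: differentiable_coord.
have -> : 'D_v (fun x : 'rV[R]_d => x 0 j : R^o) = (fun=> v 0 j) :> ('rV[R]_d -> R^o).
  apply/funext => x; rewrite -(derive_mxE _ 0 j (f := id)).
    by rewrite derive_id.
  exact: ex_diff.
exact: Ck_cst.
Qed.

End Ck.

(** * Radial integrals *)

Section UnitIntegral.
Context {R : realType}.
Implicit Types f g F : R -> R^o.
Local Notation mu := (@lebesgue_measure R).

Definition unit_integral (f : R -> R^o) : R := \int[mu]_(t in `[0, 1]) f t.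

(** Continuity is two-sided even at 0 and 1: all integrands come from functions on an open ball, and
    no one-sided limits have to be carried along. *)
Definition continuous01 (f : R -> R^o) :=
  forall t : R, 0 <= t <= 1 -> {for t, continuous f}.

Lemma continuous01_within f : continuous01 f ->
  {within `[(0 : R), 1], continuous f}.
Proof.
move=> cf; apply: continuous_in_subspaceT => t /=.
by rewrite inE /= in_itv /=; exact: cf.
Qed.

Lemma continuous01_integrable f : continuous01 f ->
  mu.-integrable `[0, 1] (EFin \o f).
Proof.
move=> cf; apply: continuous_compact_integrable; first exact: segment_compact.
exact: continuous01_within.
Qed.

Lemma unit_integralD f g : continuous01 f -> continuous01 g ->
  unit_integral (fun t => f t + g t) = unit_integral f + unit_integral g.
Proof.
by move=> cf cg; rewrite /unit_integral RintegralD //; exact: continuous01_integrable.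
Qed.

Lemma unit_integralZ (a : R) f : continuous01 f ->
  unit_integral (fun t => a * f t) = a * unit_integral f.
Proof.
by move=> cf; rewrite /unit_integral RintegralZl //; exact: continuous01_integrable.
Qed.

Lemma eq_unit_integral f g : (forall t, 0 <= t <= 1 -> f t = g t) ->
  unit_integral f = unit_integral g.
Proof.
by move=> fg; apply: eq_Rintegral => t; rewrite inE /= in_itv /=; exact: fg.
Qed.

Lemma unit_integral_cst (a : R) : unit_integral (fun=> a) = a.
Proof.
rewrite /unit_integral Rintegral_cst //= lebesgue_measure_itv /= lte_fin ltr01.
by rewrite -EFinB /= subr0 mulr1.
Qed.

Lemma unit_integral_le f (e : R) : continuous01 f ->
  (forall t, 0 <= t <= 1 -> `|f t| <= e) -> `|unit_integral f| <= e.
Proof.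
move=> cf fe; have If := continuous01_integrable cf.
apply: le_trans (le_normr_Rintegral _ _) _ => //.
rewrite -[leRHS]unit_integral_cst; apply: le_Rintegral => //.
- apply: continuous01_integrable => t t01.
  exact: (continuous_comp (cf t t01) (@norm_continuous _ R^o _)).
- by apply: continuous01_integrable => t t01; exact: cvg_cst.
Qed.

Lemma unit_integral_FTC F f : continuous01 f ->
  (forall t : R, 0 <= t <= 1 -> is_derive t 1 F (f t)) ->
  unit_integral f = F 1 - F 0.
Proof.
move=> cf dF.
have cF (t : R) : 0 <= t <= 1 -> {for t, continuous F}.
  by move=> /dF [dt _]; exact/differentiable_continuous/derivable1_diffP.
have lF : derivable_oo_LRcontinuous F 0 1.
  split=> [t||].
  - by rewrite in_itv /= => /andP[t0 t1]; case: (dF t); rewrite ?(ltW t0) ?(ltW t1).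
  - by apply: cvg_at_right_filter; apply: cF; rewrite lexx ler01.
  - by apply: cvg_at_left_filter; apply: cF; rewrite lexx ler01.
rewrite /unit_integral /Rintegral (continuous_FTC2 ltr01 (continuous01_within cf) lF) //.
move=> t; rewrite in_itv /= => /andP[t0 t1].
by rewrite derive1E; case: (dF t); rewrite ?(ltW t0) ?(ltW t1).
Qed.

Lemma continuous01D f g : continuous01 f -> continuous01 g ->
  continuous01 (fun t => f t + g t).
Proof. by move=> cf cg t t01; apply: cvgD; [exact: cf|exact: cg]. Qed.

Lemma continuous01M f g : continuous01 f -> continuous01 g ->
  continuous01 (fun t => f t * g t : R^o).
Proof. by move=> cf cg t t01; apply: cvgM; [exact: cf|exact: cg]. Qed.

Lemma continuous01_cst (a : R) : continuous01 (fun=> a).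
Proof. by move=> t _; exact: cvg_cst. Qed.

Lemma continuous01X n : continuous01 (fun t => t ^+ n : R^o).
Proof. by move=> t _; exact: exprn_continuous. Qed.

Lemma continuous01_sum I (r : seq I) (f : I -> R -> R^o) :
  (forall i, continuous01 (f i)) -> continuous01 (fun t => \sum_(i <- r) f i t).
Proof.
move=> cf; rewrite (_ : (fun t => _) = \sum_(i <- r) f i); last first.
  by apply/funext => t; rewrite fct_sumE.
elim/big_rec: _ => [|i g _ cg]; first exact: continuous01_cst.
exact: continuous01D.
Qed.

Lemma unit_integral_sum I (r : seq I) (f : I -> R -> R^o) :
  (forall i, continuous01 (f i)) ->
  unit_integral (fun t => \sum_(i <- r) f i t) =
  \sum_(i <- r) unit_integral (f i).
Proof.
move=> cf; elim: r => [|i r IH].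
  rewrite big_nil -[RHS]unit_integral_cst; apply: eq_unit_integral => t _.
  by rewrite big_nil.
rewrite big_cons -IH -unit_integralD //; last exact: continuous01_sum.
by apply: eq_unit_integral => t _; rewrite big_cons.
Qed.

End UnitIntegral.

Section Segments.
Context {R : realType} {d : nat}.
Implicit Types (f : 'rV[R]_d -> R^o) (c x y v : 'rV[R]_d).

Lemma ball_norm_subr c x (rho : R) : ball c rho x = (`|x - c| < rho) :> Prop.
Proof. by rewrite -ball_normE /ball_ /= distrC. Qed.

Lemma is_derive_line f x v t : differentiable f (x + t *: v) ->
  is_derive t 1 (fun s => f (x + s *: v)) ('D_v f (x + t *: v)).
Proof.
move=> /(@diff_derivable _ _ _ _ _ v) df.
have E : (fun h : R => h^-1 *: (((fun s => f (x + s *: v)) \o shift t) (h *: (1 : R)) -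
      f (x + t *: v))) =
    (fun h : R => h^-1 *: ((f \o shift (x + t *: v)) (h *: v) - f (x + t *: v))).
  apply/funext => h /=; congr (_ *: (f _ - _)).
  by rewrite [h *: 1]mulr1 scalerDl addrCA.
by apply: DeriveDef; rewrite ?/derivable ?/derive /= E.
Qed.

Lemma mvt_line f x v :
  (forall s, 0 <= s <= 1 -> differentiable f (x + s *: v)) ->
  exists2 s, 0 <= s <= 1 & f (x + v) - f x = 'D_v f (x + s *: v).
Proof.
move=> df.
have H (s : R) : 0 <= s <= 1 -> is_derive s 1 (fun s => f (x + s *: v)) ('D_v f (x + s *: v)).
  by move=> /df; exact: is_derive_line.
have [| |s s01] := @MVT_segment R (fun s => f (x + s *: v))
  (fun s => 'D_v f (x + s *: v)) 0 1 ler01.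
- by move=> s; rewrite in_itv /= => /andP[s0 s1]; apply: H; rewrite !ltW.
- apply: continuous01_within => s /H [dt _].
  exact/differentiable_continuous/derivable1_diffP.
rewrite scale1r scale0r addr0 subr0 mulr1 => ->.
by exists s => //; move: s01; rewrite in_itv.
Qed.

Lemma ler_norm_coord x j : `|x 0 j| <= `|x|.
Proof.
rewrite [leRHS]/Num.Def.normr /= mx_normrE.
exact: (le_bigmax _ (fun ij : 'I_1 * 'I_d => `|x ij.1 ij.2|) (0, j)).
Qed.

Lemma ball_segment c x y (rho t : R) : 0 <= t <= 1 -> ball c rho x -> ball c rho y ->
  ball c rho (x + t *: (y - x)).
Proof.
rewrite !ball_norm_subr => /andP[t0 t1] xc yc.
have -> : x + t *: (y - x) - c = (1 - t) *: (x - c) + t *: (y - c).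
  by apply/rowP => j; rewrite !mxE; ring.
apply: le_lt_trans (ler_normD _ _) _; rewrite !normrZ ger0_norm ?subr_ge0 //.
rewrite (ger0_norm t0).
have [->|tn0] := eqVneq t 0; first by rewrite subr0 mul1r mul0r addr0.
have tp : 0 < t by rewrite lt_neqAle eq_sym tn0.
have := ltr_pM2l tp; nra.
Qed.

(** The numbers [a j] assemble into a linear map that is continuous because it is a finite sum of
    coordinates; the integral and limit arguments below only have to supply the estimate. *)
Lemma differentiable_coordsP f x (a : 'I_d -> R) :
  (forall e, 0 < e -> \forall y \near x,
    `|f y - f x - \sum_j (y - x) 0 j * a j| <= e * `|y - x|) ->
  differentiable f x /\ forall v, 'D_v f x = \sum_j v 0 j * a j.
Proof.
move=> H; pose L (v : 'rV[R]_d) : R^o := \sum_j v 0 j * a j.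
have linL : linear L.
  move=> k u w; rewrite /L scaler_sumr -big_split; apply: eq_bigr => j _ /=.
  by rewrite !mxE mulrDl -mulrA.
pose LM := GRing.isLinear.Build R _ _ _ L linL.
pose LL : {linear 'rV[R]_d -> R^o} := HB.pack L LM.
apply: (@differentiable_epsP _ _ _ f x LL) => // y.
have : Ck 0 setT L.
  apply: Ck_sum => [|j _]; first exact: openT.
  by apply: CkM; [exact: openT|exact: Ck_coord|exact: Ck_cst].
by apply.
Qed.

End Segments.

Section RadialIntegral.
Context {R : realType} {d : nat}.
Variables (c : 'rV[R]_d) (rho : R).
Implicit Types (f g : 'rV[R]_d -> R^o) (x y : 'rV[R]_d).
Local Notation B := (ball c rho).
Local Notation seg t x := (c + t *: (x - c)).

(** Differentiating [f (c + t (x - c))] in [x] brings out a factor t. The weight t^m absorbs it, so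
    derivatives of these integrals are again such integrals. *)
Definition radial_integral (m : nat) (f : 'rV[R]_d -> R^o) (x : 'rV[R]_d) : R^o :=
  unit_integral (fun t => t ^+ m * f (seg t x) : R^o).
Local Notation I_ := radial_integral.

Lemma ball_radial x (t : R) : 0 <= t <= 1 -> B x -> B (seg t x).
Proof.
move=> t01 Bx; apply: ball_segment => //; move: Bx.
by rewrite !ball_norm_subr subrr normr0; exact: le_lt_trans.
Qed.

Lemma continuous01_radial m f x : Ck 0 B f -> B x ->
  continuous01 (fun t => t ^+ m * f (seg t x) : R^o).
Proof.
move=> cf Bx; apply: continuous01M; first exact: continuous01X.
move=> t t01; apply: (@continuous_comp _ _ _ (fun t : R => seg t x) f); last first.
  exact/cf/ball_radial.
by apply: cvgD; [exact: cvg_cst|apply: cvgZr_tmp; exact: cvg_id].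
Qed.

Lemma radial_integralD m f g x : Ck 0 B f -> Ck 0 B g -> B x ->
  I_ m (fun y => f y + g y) x = I_ m f x + I_ m g x.
Proof.
move=> cf cg Bx; rewrite /radial_integral -unit_integralD; last 2 first.
- exact: continuous01_radial.
- exact: continuous01_radial.
by apply: eq_unit_integral => t _; rewrite mulrDr.
Qed.

Lemma radial_integralZ m a f x : Ck 0 B f -> B x ->
  I_ m (fun y => a * f y) x = a * I_ m f x.
Proof.
move=> cf Bx; rewrite /radial_integral -unit_integralZ; last first.
  exact: continuous01_radial.
by apply: eq_unit_integral => t _; rewrite mulrCA.
Qed.

Lemma eq_radial_integral m f g x : B x -> (forall y, B y -> f y = g y) ->
  I_ m f x = I_ m g x.
Proof.
move=> Bx fg; apply: eq_unit_integral => t t01.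
by rewrite fg //; exact: ball_radial.
Qed.

Lemma radial_integralB m f g x : Ck 0 B f -> Ck 0 B g -> B x ->
  I_ m (fun y => f y - g y) x = I_ m f x - I_ m g x.
Proof.
move=> cf cg Bx; rewrite -(mulN1r (I_ m g x)) -radial_integralZ //.
rewrite -radial_integralD //; last by apply: CkZ => //; exact: ball_open.
by apply: eq_radial_integral => // y _; rewrite mulN1r.
Qed.

Lemma radial_integral_le m f x (e : R) : Ck 0 B f -> B x ->
  (forall y, B y -> `|f y| <= e) -> `|I_ m f x| <= e.
Proof.
move=> cf Bx fe; apply: unit_integral_le => [|t t01].
  exact: continuous01_radial.
have /andP[t0 t1] := t01; rewrite normrM -[e]mul1r.
apply: ler_pM => //; last by apply: fe; exact: ball_radial.
by rewrite normrX ger0_norm // exprn_ile1.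
Qed.

(** Joint continuity of the integrand in (t, x) gives a neighbourhood of [x] for each single t;
    compactness of [0, 1] makes one neighbourhood serve all t. *)
Lemma radial_uniform f x (e : R) : Ck 0 B f -> B x -> 0 < e ->
  \forall y \near x, forall t, 0 <= t <= 1 -> `|f (seg t y) - f (seg t x)| <= e.
Proof.
move=> cf Bx e0.
have : compact `[(0 : R), 1] by exact: segment_compact.
move=> /compact_near_coveringP => /(_ _ (nbhs x)
  (fun y t => `|f (seg t y) - f (seg t x)| <= e) _) [].
  move=> t; rewrite /= in_itv /= => t01.
  have c2 : (fun z : R * 'rV[R]_d => f (seg z.1 z.2)) z @[z --> (t, x)] --> f (seg t x).
    apply: (@continuous_comp _ _ _ (fun z : R * 'rV[R]_d => seg z.1 z.2) f (t, x)).
      apply: cvgD; first exact: cvg_cst.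
      apply: cvgZ; first exact: cvg_fst.
      by apply: cvgB; [exact: cvg_snd|exact: cvg_cst].
    exact/cf/ball_radial.
  have /cvgrPdist_le/(_ (e / 2)) := c2; rewrite divr_gt0 // => /(_ isT) [[P Q] /= [Pt Qx] PQ].
  exists (P, Q); first by split.
  move=> [s y] /= [Ps Qy].
  have H1 : `|f (seg t x) - f (seg s y)| <= e / 2 by apply: (PQ (s, y)).
  have H2 : `|f (seg t x) - f (seg s x)| <= e / 2.
    by apply: (PQ (s, x)); split => //=; exact: nbhs_singleton.
  rewrite (splitr e) -(subrK (f (seg t x)) (f (seg s y))) -addrA.
  by apply: le_trans (ler_normD _ _) _; rewrite lerD // distrC.
move=> P Px HP; exists P => //.
Qed.

End RadialIntegral.

Section RadialCalculus.
Context {R : realType} {d : nat}.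
Variables (c : 'rV[R]_d) (rho : R).
Implicit Types (f g : 'rV[R]_d -> R^o) (x y : 'rV[R]_d).
Local Notation B := (ball c rho).
Local Notation seg t x := (c + t *: (x - c)).
Local Notation I_ := (radial_integral c).
Local Notation "''d_' j f" := ('D_(delta_mx 0 j) f) (at level 10, j, f at next level).
Let oB : open B := ball_open _ _.

Lemma radial_continuous m f x : Ck 0 B f -> B x -> {for x, continuous (I_ m f)}.
Proof.
move=> cf Bx; apply/(@cvgrPdist_le _ _ _ (nbhs x)) => e e0.
have nB : \forall y \near x, B y by exact: open_nbhs_nbhs.
move: nB (radial_uniform cf Bx e0); apply: filterS2 => y By Hy.
rewrite distrC /radial_integral -[X in _ - X]mul1r -mulNr.
rewrite -unit_integralZ; last exact: (continuous01_radial cf Bx).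
rewrite -unit_integralD; first last.
- by apply: continuous01M; [exact: continuous01_cst|exact: (continuous01_radial cf Bx)].
- exact: (continuous01_radial cf By).
apply: unit_integral_le => [|t t01].
  apply: continuous01D; first exact: (continuous01_radial cf By).
  by apply: continuous01M; [exact: continuous01_cst|exact: (continuous01_radial cf Bx)].
rewrite mulN1r -mulrBr normrM -[e]mul1r; have /andP[t0 t1] := t01.
apply: ler_pM => //; first by rewrite normrX ger0_norm // exprn_ile1.
exact: Hy.
Qed.

(** Differentiation under the integral: for each t the increment of [f] is a derivative at an
    intermediate point, and [radial_uniform] bounds the change of the partial derivatives uniformly
    in t. The displacement [t *: (y - x)] accounts for the weight [m.+1]. *)
Lemma radial_differentiable m f x : Ck 1 B f -> B x ->
  differentiable (I_ m f) x /\
  forall v, 'D_v (I_ m f) x = \sum_j v 0 j * I_ m.+1 ('d_j f) x.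
Proof.
move=> Hf Bx; have cf := Ck_leS Hf; case: Hf => df ddf.
apply: differentiable_coordsP => e e0.
(* Each coordinate gets an equal share of [e]. With [d.+1] shares the division is harmless for
   [d = 0], and the surplus share is dropped at the end. *)
have e'0 : 0 < e / d.+1%:R by rewrite divr_gt0.
have : \forall y \near x, B y /\ forall j : 'I_d, forall t, 0 <= t <= 1 ->
    `|'d_j f (seg t y) - 'd_j f (seg t x)| <= e / d.+1%:R.
  have nB : \forall y \near x, B y by exact: open_nbhs_nbhs.
  have nU : \forall y \near x, forall j : 'I_d, forall t, 0 <= t <= 1 ->
      `|'d_j f (seg t y) - 'd_j f (seg t x)| <= e / d.+1%:R.
    apply: (@filter_forall _ _ (fun j y => forall t, 0 <= t <= 1 ->
      `|'d_j f (seg t y) - 'd_j f (seg t x)| <= e / d.+1%:R) (nbhs x)) => j.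
    exact: (radial_uniform (ddf _) Bx e'0).
  by move: nB nU; apply: filterS2 => y By Hy; split.
move=> /nbhs_ballP[delta /= delta0 H].
apply/nbhs_ballP; exists delta => //= y xy.
have [By _] := H _ xy.
have cd j : continuous01 (fun t => t ^+ m.+1 * 'd_j f (seg t x) : R^o).
  exact: (@continuous01_radial _ _ _ _ _ _ _ (ddf (delta_mx 0 j)) Bx).
have cx := continuous01_radial cf Bx; have cy := continuous01_radial cf By.
have cs : continuous01 (fun t => \sum_j - (y - x) 0 j * (t ^+ m.+1 * 'd_j f (seg t x)) : R^o).
  apply: continuous01_sum => j; apply: continuous01M; first exact: continuous01_cst.
  exact: cd.
have cNx : continuous01 (fun t => -1 * (t ^+ m * f (seg t x)) : R^o).
  by apply: continuous01M => //; exact: continuous01_cst.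
have -> : I_ m f y - I_ m f x - \sum_j (y - x) 0 j * I_ m.+1 ('d_j f) x =
    unit_integral (fun t => t ^+ m * f (seg t y) + -1 * (t ^+ m * f (seg t x))
      + \sum_j - (y - x) 0 j * (t ^+ m.+1 * 'd_j f (seg t x)) : R^o).
  rewrite unit_integralD //; last exact: continuous01D.
  rewrite unit_integralD // unit_integralZ // mulN1r -sumrN.
  congr (_ + _); rewrite unit_integral_sum; last first.
    by move=> j; apply: continuous01M; [exact: continuous01_cst|exact: cd].
  by apply: eq_bigr => j _; rewrite unit_integralZ // mulNr.
apply: unit_integral_le => [|t t01].
  by apply: continuous01D => //; exact: continuous01D.
have bs s : 0 <= s <= 1 -> ball x delta (x + s *: (y - x)).
  move=> s01; apply: (ball_segment s01 _ xy).
  by rewrite ball_norm_subr subrr normr0.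
have segE s : seg t x + s *: (t *: (y - x)) = seg t (x + s *: (y - x)).
  by apply/rowP => j; rewrite !mxE; ring.
(* The intermediate [s] depends on t in an uncontrolled way. This does no harm: the integrand,
   already known to be continuous, is only bounded pointwise. *)
have [|s s01] := @mvt_line R d f (seg t x) (t *: (y - x)).
  move=> s s01; rewrite segE; apply: df; apply: ball_radial => //.
  by have [] := H _ (bs s s01).
have -> : seg t x + t *: (y - x) = seg t y by apply/rowP => j; rewrite !mxE; ring.
rewrite segE derive_coord; last first.
  by apply: df; apply: ball_radial => //; have [] := H _ (bs s s01).
move=> fE; rewrite mulN1r -mulrBr fE mulr_sumr -big_split /=.
apply: le_trans (ler_norm_sum _ _ _) _.
have -> : e * `|y - x| = \sum_(j < d.+1) e / d.+1%:R * `|y - x|.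
  by rewrite sumr_const card_ord -mulr_natl; field.
rewrite big_ord_recr /= -[X in X <= _]addr0; apply: lerD; last first.
  by rewrite mulr_ge0 // ltW.
apply: ler_sum => j _.
have -> : t ^+ m * ((t *: (y - x)) 0 j *: 'd_j f (seg t (x + s *: (y - x)))) +
    - (y - x) 0 j * (t ^+ m.+1 * 'd_j f (seg t x)) =
  t ^+ m.+1 * (('d_j f (seg t (x + s *: (y - x))) - 'd_j f (seg t x)) * (y - x) 0 j).
  by rewrite /GRing.scale /= !mxE exprS; ring.
rewrite normrM -[leRHS]mul1r; have /andP[t0 t1] := t01.
apply: ler_pM => //; first by rewrite normrX ger0_norm // exprn_ile1.
rewrite normrM; apply: ler_pM => //; last exact: ler_norm_coord.
by have [_] := H _ (bs s s01); apply.
Qed.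

Lemma derive_radial m f x j : Ck 1 B f -> B x ->
  'd_j (I_ m f) x = I_ m.+1 ('d_j f) x.
Proof.
move=> Hf Bx; have [_ ->] := radial_differentiable m Hf Bx.
rewrite (bigD1 j) //= !mxE !eqxx mul1r big1 ?addr0 // => i ij.
by rewrite !mxE (negbTE ij) andbF mul0r.
Qed.

Lemma Ck_radial k m f : Ck k B f -> Ck k B (I_ m f).
Proof.
elim: k m f => [|k IH] m f Hf.
  by move=> x Bx; exact: radial_continuous Hf Bx.
have H1 : Ck 1 B f.
  by elim: k Hf {IH} => // k IH' /Ck_leS; exact: IH'.
split=> [x Bx|v]; first by have [] := radial_differentiable m H1 Bx.
apply: (@Ck_eq _ _ _ _ _ (fun x => \sum_j v 0 j * I_ m.+1 ('d_j f) x)) => //.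
  by move=> x Bx; have [_ ->] := radial_differentiable m H1 Bx.
apply: Ck_sum => // j _; apply: CkZ => //; apply: IH.
exact: Hf.2.
Qed.

(** Integrate the t-derivative of t^(m+1) f(c + t (x - c)) over [0, 1]; the factor t^(m+1) kills the
    boundary term at 0. This is the integration by parts on which all later cancellations rest. *)
Lemma radial_FTC m f x : Ck 1 B f -> B x ->
  f x = m.+1%:R * I_ m f x + \sum_j (x - c) 0 j * I_ m.+1 ('d_j f) x.
Proof.
move=> Hf Bx; have cf := Ck_leS Hf; case: Hf => df ddf.
have cd j : continuous01 (fun t => t ^+ m.+1 * 'd_j f (seg t x) : R^o).
  exact: (@continuous01_radial _ _ _ _ _ _ _ (ddf (delta_mx 0 j)) Bx).
have c1 : continuous01 (fun t => m.+1%:R * (t ^+ m * f (seg t x)) : R^o).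
  apply: continuous01M; first exact: continuous01_cst.
  exact: (continuous01_radial cf Bx).
have c2 : continuous01 (fun t => \sum_j (x - c) 0 j * (t ^+ m.+1 * 'd_j f (seg t x)) : R^o).
  apply: continuous01_sum => j; apply: continuous01M; first exact: continuous01_cst.
  exact: cd.
transitivity (unit_integral (fun t => m.+1%:R * (t ^+ m * f (seg t x)) +
    \sum_j (x - c) 0 j * (t ^+ m.+1 * 'd_j f (seg t x)) : R^o)); last first.
  rewrite unit_integralD // unit_integralZ; last exact: (continuous01_radial cf Bx).
  congr (_ + _); rewrite unit_integral_sum; last first.
    by move=> j; apply: continuous01M; [exact: continuous01_cst|exact: cd].
  by apply: eq_bigr => j _; rewrite unit_integralZ.
apply/esym; pose F (t : R) : R^o := t ^+ m.+1 * f (seg t x).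
apply: (etrans (@unit_integral_FTC _ F _ _ _)).
- exact: continuous01D.
- move=> t t01.
  have Bt : B (seg t x) by exact: ball_radial.
  have D1 := @is_derive_line R d f c (x - c) t (df _ Bt).
  have D2 : is_derive t 1 (fun t : R => t ^+ m.+1 : R^o) (m.+1%:R * t ^+ m).
    apply: DeriveDef; first exact: exprn_derivable.
    by rewrite exp_derive /= /GRing.scale /= mulr1 mulr_natl.
  have [dF vF] := is_deriveM D2 D1; apply: DeriveDef; first exact: dF.
  apply: (etrans vF).
  rewrite derive_coord; last exact: df.
  rewrite addrC /GRing.scale /=; congr (_ + _); first by ring.
  by rewrite mulr_sumr; apply: eq_bigr => j _; rewrite /GRing.scale /=; ring.
- by rewrite /F expr1n mul1r scale1r subrKC expr0n mul0r subr0.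
Qed.

(** The case m = -1 of the preceding formula: without a power of t the boundary value [f c]
    survives. *)
Lemma radial_FTC0 f x : Ck 1 B f -> B x ->
  f x - f c = \sum_j (x - c) 0 j * I_ 0 ('d_j f) x.
Proof.
move=> [df ddf] Bx.
have cd j : continuous01 (fun t => t ^+ 0 * 'd_j f (seg t x) : R^o).
  exact: (@continuous01_radial _ _ _ _ _ _ _ (ddf (delta_mx 0 j)) Bx).
transitivity (unit_integral (fun t => \sum_j (x - c) 0 j * (t ^+ 0 * 'd_j f (seg t x)) : R^o)).
  apply/esym; apply: (etrans (@unit_integral_FTC _ (fun t => f (seg t x)) _ _ _)).
  - apply: continuous01_sum => j; apply: continuous01M; first exact: continuous01_cst.
    exact: cd.
  - move=> t t01; have Bt : B (seg t x) by exact: ball_radial.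
    have [dF vF] := @is_derive_line R d f c (x - c) t (df _ Bt).
    apply: DeriveDef; first exact: dF.
    apply: (etrans vF).
    rewrite derive_coord; last exact: df.
    by apply: eq_bigr => j _; rewrite expr0 mul1r.
  - by rewrite scale1r subrKC scale0r addr0.
rewrite unit_integral_sum; last first.
  by move=> j; apply: continuous01M; [exact: continuous01_cst|exact: cd].
by apply: eq_bigr => j _; rewrite unit_integralZ.
Qed.

End RadialCalculus.

(** * The Poincaré homotopy operator *)

Section Homotopy.
Context {R : realType} {d : nat}.
Variables (c : 'rV[R]_d) (rho : R).
Implicit Types (f g : 'rV[R]_d -> R^o) (x y : 'rV[R]_d).
Local Notation B := (ball c rho).
Local Notation I_ := (radial_integral c).
Local Notation "''d_' j f" := ('D_(delta_mx 0 j) f) (at level 10, j, f at next level).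
Let oB : open B := ball_open _ _.

(** A 1-form is contracted with the radial vector field and integrated along the ray. Weight 0 is
    the homotopy operator on functions and 1-forms; weight 1, applied to the components of a 2-form
    with one index fixed, gives its primitive. *)
Definition radial_homotopy m (a : 'I_d -> 'rV[R]_d -> R^o) (x : 'rV[R]_d) : R^o :=
  \sum_j (x - c) 0 j * I_ m (a j) x.

Lemma Ck_coordB k (U : set 'rV[R]_d) j : open U -> Ck k U (fun x => (x - c) 0 j : R^o).
Proof.
move=> oU; apply: (@Ck_eq _ _ _ _ _ (fun x => x 0 j - c 0 j : R^o)) => //.
  by move=> x _; rewrite !mxE.
by apply: CkB => //; [exact: Ck_coord|exact: Ck_cst].
Qed.

Lemma Ck_homotopy k m a : (forall j, Ck k B (a j)) -> Ck k B (radial_homotopy m a).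
Proof.
move=> Ha; apply: Ck_sum => // j _; apply: CkM => //; last exact: Ck_radial.
exact: Ck_coordB.
Qed.

Lemma derive_coordB x v j : 'D_v (fun y => (y - c) 0 j : R^o) x = v 0 j.
Proof.
have [|dc ->] := @differentiable_coordsP _ _ (fun y => (y - c) 0 j : R^o) x
  (fun i => (i == j)%:R).
  move=> e e0; apply/nbhs_ballP; exists 1 => //= y _; rewrite (bigD1 j) //= eqxx mulr1 big1.
    by rewrite !mxE addr0 opprB addrA subrK subrr normr0 mulr_ge0 // ltW.
  by move=> i /negbTE->; rewrite mulr0.
by rewrite (bigD1 j) //= eqxx mulr1 big1 ?addr0 // => i /negbTE->; rewrite mulr0.
Qed.

Lemma Ck1_derivable k (V W : normedModType R) (U : set V) (f : V -> W) (x v : V) :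
  Ck k.+1 U f -> U x -> derivable f x v.
Proof. by move=> [df _] Ux; exact/diff_derivable/df. Qed.

Lemma derive_homotopy m a i x : (forall j, Ck 1 B (a j)) -> B x ->
  'd_i (radial_homotopy m a) x = I_ m (a i) x + radial_homotopy m.+1 (fun j => 'd_i (a j)) x.
Proof.
move=> Ha Bx.
have H j : is_derive x (delta_mx 0 i) (fun y => (y - c) 0 j * I_ m (a j) y : R^o)
    ((x - c) 0 j * I_ m.+1 ('d_i (a j)) x + (j == i)%:R * I_ m (a j) x).
  have d1 : derivable (fun y => (y - c) 0 j : R^o) x (delta_mx 0 i).
    exact: (Ck1_derivable (@Ck_coordB 1 _ j oB) Bx).
  have d2 : derivable (I_ m (a j)) x (delta_mx 0 i).
    exact: (Ck1_derivable (Ck_radial m (Ha j)) Bx).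
  apply: DeriveDef; first exact: (derivableM d1 d2).
  apply: (etrans (deriveM d1 d2)).
  rewrite (derive_radial m i (Ha j) Bx) derive_coordB !mxE eqxx /= /GRing.scale /=.
  by congr (_ + _); rewrite mulrC.
have -> : radial_homotopy m a = \sum_j (fun y => (y - c) 0 j * I_ m (a j) y : R^o).
  by apply/funext => y; rewrite fct_sumE.
rewrite derive_sum; last by move=> j; case: (H j).
transitivity (\sum_j ((x - c) 0 j * I_ m.+1 ('d_i (a j)) x + (j == i)%:R * I_ m (a j) x)).
  by apply: eq_bigr => j _; case: (H j).
rewrite big_split /= addrC; congr (_ + _).
by rewrite (bigD1 i) //= eqxx mul1r big1 ?addr0 // => j /negbTE->; rewrite mul0r.
Qed.

Lemma homotopy_FTC0 f x : Ck 1 B f -> B x ->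
  f x - f c = radial_homotopy 0 (fun j => 'd_j f) x.
Proof. exact: radial_FTC0. Qed.

Lemma homotopy_FTC m f x : Ck 1 B f -> B x ->
  f x = m.+1%:R * I_ m f x + radial_homotopy m.+1 (fun j => 'd_j f) x.
Proof. exact: radial_FTC. Qed.

End Homotopy.

(** * Symmetry of second derivatives and the Poincaré lemma *)

Section Poincare.
Context {R : realType} {d : nat}.
Implicit Types (f g : 'rV[R]_d -> R^o) (x y c : 'rV[R]_d).
Local Notation "''d_' j f" := ('D_(delta_mx 0 j) f) (at level 10, j, f at next level).

(** The ray at the centre is degenerate, so only the integral of t^m is left. Its value is read off
    [homotopy_FTC] for the constant function 1, where the homotopy term vanishes at [c]. *)
Lemma radial_integral_center m f c : radial_integral c m f c = f c * m.+1%:R^-1.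
Proof.
have B1 : ball c 1 c := ballxx _ ltr01.
have C0 : Ck 0 (ball c 1) (cst (f c)) by exact: Ck_cst.
transitivity (radial_integral c m (fun=> f c * 1) c).
  by apply: eq_unit_integral => t _; rewrite subrr scaler0 addr0 mulr1.
rewrite (radial_integralZ m (f c) (@Ck_cst _ _ _ 0 (ball c 1) (1 : R^o)) B1).
congr (_ * _).
have := homotopy_FTC m (@Ck_cst _ _ _ 1 (ball c 1) (1 : R^o)) B1.
rewrite /radial_homotopy big1 ?addr0 => [E|j _]; last first.
  by rewrite subrr mxE mul0r.
by apply: (mulfI (x := m.+1%:R)); rewrite ?pnatr_eq0 // -E divff ?pnatr_eq0.
Qed.

(* Differentiating the two radial integral formulas for f shows that the
   radial integrals of the two mixed derivatives agree along every axis. *)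
Lemma derive_swap (c : 'rV[R]_d) (U : set 'rV[R]_d) f i j : open U -> U c -> Ck 2 U f ->
  'd_i ('d_j f) c = 'd_j ('d_i f) c.
Proof.
move=> oU Uc Hf.
have /nbhs_ballP[rho /= rho0 BU] : nbhs c U by exact: open_nbhs_nbhs.
have {U oU Uc BU}Hf := Ck_subset BU Hf.
set B := ball c rho in Hf.
have Hd k : Ck 1 B ('d_k f) by exact: Hf.2.
have Hdd k l : Ck 0 B ('d_l ('d_k f)) by exact: (Hd k).2.
have oB : open B := ball_open _ _.
have E x : B x -> radial_homotopy c 1 (fun k => 'd_k ('d_i f)) x =
    radial_homotopy c 1 (fun k => 'd_i ('d_k f)) x.
  move=> Bx; apply: (addrI (radial_integral c 0 ('d_i f) x)).
  apply: (etrans _ (derive_homotopy 0 i Hd Bx)).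
  have F := homotopy_FTC 0 (Hd i) Bx; rewrite mul1r in F.
  apply: (etrans (esym F)); apply/esym.
  have : {near x, radial_homotopy c 0 (fun k => 'd_k f) =1 (fun y => f y - f c)}.
    apply: filterS (open_nbhs_nbhs (conj oB Bx)) => y By.
    exact/esym/(homotopy_FTC0 (Ck_leS Hf) By).
  move=> /near_eq_derive ->; rewrite deriveB; last 2 first.
  - exact/diff_derivable/Hf.1.
  - exact: derivable_cst.
  by rewrite derive_cst subr0.
pose h x : R^o := 'd_i ('d_j f) x - 'd_j ('d_i f) x.
have Ch : Ck 0 B h by apply: CkB => //; exact: Hdd.
have Bc : B c by exact: ballxx.
(* At the centre this integral is [h c / 2]. It is also continuous there, so it is enough to see it
   vanish at points arbitrarily close to [c]. *)
suff : radial_integral c 1 h c = 0.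
  rewrite radial_integral_center => /eqP; rewrite mulf_eq0 invr_eq0 pnatr_eq0 orbF.
  by rewrite subr_eq0 => /eqP.
have /(@cvgrPdist_lt _ _ _ (nbhs c)) H := @radial_continuous _ _ _ _ 1 _ _ Ch Bc.
apply/eqP; rewrite -normr_le0; apply/ler_addgt0Pr => e e0; rewrite add0r.
have /nbhs_ballP[delta /= delta0 {}H] := H e e0.
pose s := Num.min delta rho / 2.
have m0 : 0 < Num.min delta rho by rewrite lt_min delta0.
have md : Num.min delta rho <= delta by rewrite ge_min lexx.
have mr : Num.min delta rho <= rho by rewrite ge_min lexx orbT.
have s0 : 0 < s by rewrite /s; lra.
have sd : s < delta by rewrite /s; lra.
have sr : s < rho by rewrite /s; lra.
(* On the j-th axis the homotopy sum has a single nonzero term, and [E] becomes [s] times an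
   equality of radial integrals. This is why the test points must avoid [s = 0]. *)
pose x := c + s *: delta_mx 0 j : 'rV[R]_d.
have xc : x - c = s *: delta_mx 0 j by rewrite /x addrC addKr.
have nx : `|x - c| <= s.
  rewrite xc normrZ gtr0_norm // ger_pMr //.
  rewrite {1}/Num.Def.normr /= mx_normrE; apply: bigmax_le => // -[a b] _ /=.
  by rewrite mxE; case: eqP; case: eqP; rewrite ?normr1 ?normr0.
have Bx : B x by rewrite /B ball_norm_subr (le_lt_trans nx).
have := H x; rewrite ball_norm_subr (le_lt_trans nx) // => /(_ isT).
suff -> : radial_integral c 1 h x = 0 by rewrite subr0 => /ltW.
rewrite (radial_integralB 1 (Hdd j i) (Hdd i j) Bx).
apply/eqP; rewrite subr_eq0; apply/eqP.
have S a : radial_homotopy c 1 a x = s * radial_integral c 1 (a j) x.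
  rewrite /radial_homotopy xc (bigD1 j) //= !mxE !eqxx mulr1 big1 ?addr0 //.
  by move=> k /negbTE kj; rewrite !mxE kj andbF mulr0 mul0r.
apply: (mulfI (lt0r_neq0 s0)).
exact: (etrans (esym (S _)) (etrans (esym (E x Bx)) (S _))).
Qed.

(** The primitive is the weight 1 homotopy of [w] in its first index. In its exterior derivative the
    undifferentiated terms give twice the weight 1 integral of [w i j], by antisymmetry; closedness
    turns the others into the weight 2 homotopy of the gradient of [w i j]. [homotopy_FTC] with m =
    1 adds them up to [w i j]. *)
Lemma poincare2 c (rho : R) (w : 'I_d -> 'I_d -> 'rV[R]_d -> R^o) :
  (forall k i j, Ck k (ball c rho) (w i j)) ->
  (forall i j x, ball c rho x -> w i j x = - w j i x) ->
  (forall i j k x, ball c rho x ->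
     'd_i (w j k) x + 'd_j (w k i) x + 'd_k (w i j) x = 0) ->
  exists l : 'I_d -> 'rV[R]_d -> R^o,
    (forall k i, Ck k (ball c rho) (l i)) /\
    forall i j x, ball c rho x -> 'd_i (l j) x - 'd_j (l i) x = w i j x.
Proof.
move=> Cw aw cw; set B := ball c rho.
have oB : open B := ball_open _ _.
exists (fun i => radial_homotopy c 1 (fun k => w k i)); split.
  by move=> k i; apply: Ck_homotopy => j; exact: Cw.
move=> i j x Bx; rewrite !(derive_homotopy _ _ (fun k => Cw 1%N k _) Bx).
rewrite [RHS](homotopy_FTC 1 (Cw _ i j) Bx) mulr2n mulrDl mul1r opprD addrACA.
have -> : - radial_integral c 1 (w j i) x = radial_integral c 1 (w i j) x.
  rewrite -mulN1r -(radial_integralZ _ _ (Cw 0%N _ _) Bx).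
  by apply: (eq_radial_integral _ Bx) => y By; rewrite mulN1r -aw.
congr (_ + _); rewrite /radial_homotopy -sumrB; apply: eq_bigr => k _.
rewrite -mulrBr -(radial_integralB _ _ _ Bx); first last.
- exact: (Cw 1%N _ _).2.
- exact: (Cw 1%N _ _).2.
congr (_ * _); apply: (eq_radial_integral _ Bx) => y By.
have /eqP := cw i j k y By; rewrite addrC addr_eq0 => /eqP ->.
rewrite opprD; congr (_ - _).
have ny : {near y, w j k =1 (- w k j)}.
  by apply: filterS (open_nbhs_nbhs (conj oB By)) => z Bz; rewrite aw.
rewrite (near_eq_derive _ ny) deriveN ?opprK //.
exact: (Ck1_derivable (Cw 1%N _ _) By).
Qed.

End Poincare.

(** * Flat linear systems *)

Section Geometric.
Context {R : realType}.
Local Notation half k := ((2%:R^-1 : R) ^+ k).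

Lemma half_ge0 k : 0 <= half k. Proof. by rewrite exprn_ge0 // invr_ge0. Qed.

Lemma le_addr_half (A b C : R) : (forall k : nat, A <= b + C * half k) -> A <= b.
Proof.
move=> H.
have cv : (b + C * half k) @[k --> \oo] --> b.
  rewrite -[X in _ --> X]addr0; apply: cvgD; first exact: cvg_cst.
  rewrite -[X in _ --> X](mulr0 C); apply: cvgM; first exact: cvg_cst.
  by apply: cvg_expr; rewrite ger0_norm ?invr_ge0 // invf_lt1 // ltr1n.
apply: (cvgr_to_ge cv); exact: nearW.
Qed.

Lemma half_small (C e : R) : 0 < e -> exists k : nat, C * half k <= e.
Proof.
move=> e0; apply: contrapT => /forallNP H.
have : e <= 0.
  apply: (@le_addr_half _ _ C) => k; rewrite add0r.
  by have /negP := H k; rewrite -ltNge => /ltW.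
by rewrite leNgt e0.
Qed.

Lemma half_contract (e : R) k : 0 <= e -> 8%:R^-1 * (e * half k) <= e * half k.+1.
Proof. by move=> e0; rewrite exprS; have := mulr_ge0 e0 (half_ge0 k); lra. Qed.

(** The budget of one defect step: the two products of [B] with defects cost an eighth each, the
    difference of two Picard iterates a quarter, together one half. This is where the bound 1/8 in
    the smallness condition comes from. *)
Lemma quarter_sum (u t : R) : u <= 8%:R^-1 * t -> 2%:R * u + t / 4%:R <= t / 2%:R.
Proof. by move=> ut; lra. Qed.

(** The sequences [s k - 2 D / 2^k] and [s k + 2 D / 2^k] are increasing and decreasing, so the
    supremum of the first lies between them for every k. *)
Lemma geometric_limit (s : nat -> R) (D : R) :
  (forall k, `|s k.+1 - s k| <= D * half k) ->
  exists l, forall k, `|l - s k| <= 2 * D * half k.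
Proof.
move=> H; pose a k := s k - 2 * D * half k; pose b k := s k + 2 * D * half k.
have hS k : half k = 2 * half k.+1 by rewrite exprS mulrA divff ?mul1r.
have aS k : a k <= a k.+1.
  by move: (H k); rewrite /a ler_norml => /andP[H1 H2]; move: (hS k); nra.
have bS k : b k.+1 <= b k.
  by move: (H k); rewrite /b ler_norml => /andP[H1 H2]; move: (hS k); nra.
have D0 : 0 <= D.
  by have := le_trans (normr_ge0 _) (H 0%N); rewrite expr0 mulr1.
have ab k : a k <= b k.
  by rewrite /a /b; have := mulr_ge0 D0 (half_ge0 k); lra.
have abjk j k : a j <= b k.
  apply: (@le_trans _ _ (a (maxn j k))).
    exact: (homo_leq (f := a) (r := <=%R) (@lexx _ R) (@le_trans _ R) aS (leq_maxl j k)).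
  apply: le_trans (ab _) _.
  apply: (homo_leq (f := b) (r := fun x y : R => y <= x) (@lexx _ R) _ bS (leq_maxr j k)).
  by move=> x y z xy yz; exact: le_trans yz xy.
have ubk k : ubound (range a) (b k) by move=> _ [j _ <-].
have ne : range a !=set0 by exists (a 0%N), 0%N.
exists (sup (range a)) => k.
have H1 : a k <= sup (range a).
  by apply: ub_le_sup; [exists (b 0%N); exact: ubk|exists k].
have H2 : sup (range a) <= b k by apply: ge_sup => //; exact: ubk.
by rewrite ler_norml; move: H1 H2; rewrite /a /b => *; apply/andP; split; lra.
Qed.

End Geometric.

Section LinearSystem.
Context {R : realType} {d : nat} {J : finType}.
Variables (c : 'rV[R]_d) (r : R) (B : 'I_d -> J -> J -> 'rV[R]_d -> R^o) (M : R).
Local Notation half k := ((2%:R^-1 : R) ^+ k).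
Local Notation S := (ball c r).
Local Notation "''d_' j f" := ('D_(delta_mx 0 j) f) (at level 10, j, f at next level).
Let oS : open S := ball_open _ _.
Let N : R := #|J|%:R.
Hypothesis r_gt0 : 0 < r.
Hypothesis CB : forall k i a b, Ck k S (B i a b).
Hypothesis M_ge0 : 0 <= M.
Hypothesis BM : forall i a b x, S x -> `|B i a b x| <= M.
(* With this constant both the Picard step and its defect contract by 1/2. *)
Hypothesis small : d%:R * r * (N * M) <= 8%:R^-1.

Let N_ge0 : 0 <= N. Proof. by []. Qed.

Lemma system_bound i a (w : J -> 'rV[R]_d -> R^o) (e : R) x : S x ->
  (forall b, `|w b x| <= e) -> `|\sum_b B i a b x * w b x| <= N * M * e.
Proof.
move=> Sx we; apply: le_trans (ler_norm_sum _ _ _) _.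
rewrite /N -mulrA mulr_natl -sumr_const; apply: ler_sum => b _.
by rewrite normrM ler_pM // BM.
Qed.

Lemma homotopy_bound m (al : 'I_d -> 'rV[R]_d -> R^o) (e : R) x :
  (forall i, Ck 0 S (al i)) -> (forall i y, S y -> `|al i y| <= e) -> S x ->
  `|radial_homotopy c m al x| <= d%:R * r * e.
Proof.
move=> Ca ae Sx; apply: le_trans (ler_norm_sum _ _ _) _.
rewrite -mulrA mulr_natl -[d in leRHS]card_ord -sumr_const; apply: ler_sum => i _.
rewrite normrM; apply: ler_pM => //.
  apply: le_trans (ler_norm_coord _ _) _.
  by move: Sx; rewrite ball_norm_subr => /ltW.
by apply: (radial_integral_le _ (Ca i) Sx) => y; exact: ae.
Qed.

Lemma Ck_system k i a (w : J -> 'rV[R]_d -> R^o) : (forall b, Ck k S (w b)) ->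
  Ck k S (fun x => \sum_b B i a b x * w b x).
Proof. by move=> Cw; apply: Ck_sum => // b _; exact: CkM. Qed.

Lemma homotopy_system_bound m a (w : J -> 'rV[R]_d -> R^o) (e : R) x :
  (forall b, Ck 0 S (w b)) -> 0 <= e -> (forall b y, S y -> `|w b y| <= e) -> S x ->
  `|radial_homotopy c m (fun j y => \sum_b B j a b y * w b y) x| <= 8%:R^-1 * e.
Proof.
move=> Cw e0 we Sx; apply: (@le_trans _ _ (d%:R * r * (N * M * e))).
  apply: homotopy_bound => // [i|i y Sy]; first exact: (@Ck_system 0 i a w Cw).
  by apply: system_bound => // b; exact: we.
by rewrite mulrA; apply: ler_wpM2r.
Qed.

(** Because [w] vanishes at the centre, [homotopy_FTC0] makes it a fixed point of the linear Picard
    map, which contracts by [homotopy_system_bound]; any bound on [w] can therefore be halved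
    indefinitely. *)
Lemma system_unique (w : J -> 'rV[R]_d -> R^o) (e : R) :
  (forall a, Ck 1 S (w a)) ->
  (forall a, w a c = 0) ->
  (forall i a x, S x -> 'd_i (w a) x = - \sum_b B i a b x * w b x) ->
  (forall a x, S x -> `|w a x| <= e) ->
  forall a x, S x -> w a x = 0.
Proof.
move=> Cw w0 dw we.
(* For empty [J] the bound says nothing about the sign of [e], hence the dependence on an index. *)
have e0 : J -> 0 <= e.
  by move=> a; apply: le_trans (normr_ge0 _) (we a c (ballxx _ r_gt0)).
have H k : forall a x, S x -> `|w a x| <= e * half k.
  elim: k => [|k IH] a x Sx; first by rewrite expr0 mulr1 we.
  have -> : w a x = - radial_homotopy c 0 (fun j y => \sum_b B j a b y * w b y) x.
    have FT := homotopy_FTC0 (Cw a) Sx; rewrite w0 subr0 in FT.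
    rewrite FT /radial_homotopy -sumrN.
    apply: eq_bigr => j _; rewrite -mulrN; congr (_ * _).
    rewrite -mulN1r -(radial_integralZ _ _ _ Sx); last first.
      exact: (@Ck_system 0 j a w (fun b => Ck_leS (Cw b))).
    by apply: (eq_radial_integral _ Sx) => y Sy; rewrite dw // mulN1r.
  rewrite normrN; apply: le_trans (homotopy_system_bound _ _ _ _ IH Sx) _.
  - by move=> b; exact: Ck_leS.
  - by rewrite mulr_ge0 ?half_ge0 // e0.
  - exact/half_contract/e0.
move=> a x Sx; apply/eqP; rewrite -normr_le0; apply: (@le_addr_half _ _ 0 e) => k.
by rewrite add0r H.
Qed.

Lemma radial_homotopyB m (al be : 'I_d -> 'rV[R]_d -> R^o) x :
  (forall j, Ck 0 S (al j)) -> (forall j, Ck 0 S (be j)) -> S x ->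
  radial_homotopy c m (fun j y => al j y - be j y) x =
  radial_homotopy c m al x - radial_homotopy c m be x.
Proof.
move=> Ca Cb Sx; rewrite /radial_homotopy -sumrB; apply: eq_bigr => j _.
by rewrite -mulrBr (radial_integralB m (Ca j) (Cb j) Sx).
Qed.

Lemma eq_radial_homotopy m (al be : 'I_d -> 'rV[R]_d -> R^o) x :
  (forall j y, S y -> al j y = be j y) -> S x ->
  radial_homotopy c m al x = radial_homotopy c m be x.
Proof.
move=> ab Sx; apply: eq_bigr => j _; congr (_ * _).
by apply: (eq_radial_integral _ Sx) => y; exact: ab.
Qed.

Lemma derive_system i j a (w : J -> 'rV[R]_d -> R^o) x :
  (forall b, Ck 1 S (w b)) -> S x ->
  'd_j (fun y => \sum_b B i a b y * w b y : R^o) x =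
  \sum_b ('d_j (B i a b) x * w b x + B i a b x * 'd_j (w b) x).
Proof.
move=> Cw Sx.
have H b : is_derive x (delta_mx 0 j) (fun y => B i a b y * w b y : R^o)
    ('d_j (B i a b) x * w b x + B i a b x * 'd_j (w b) x).
  have d1 : derivable (B i a b) x (delta_mx 0 j) := Ck1_derivable (CB 1 i a b) Sx.
  have d2 : derivable (w b) x (delta_mx 0 j) := Ck1_derivable (Cw b) Sx.
  apply: DeriveDef; first exact: (derivableM d1 d2).
  by apply: (etrans (deriveM d1 d2)); rewrite addrC /GRing.scale /= [w b x * _]mulrC.
pose F b y : R^o := B i a b y * w b y.
have -> : (fun y => \sum_b B i a b y * w b y : R^o) = \sum_(k < #|J|) F (enum_val k).
  by apply/funext => y; rewrite fct_sumE; apply: (reindex _ (onW_bij _ (enum_val_bij _))).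
rewrite derive_sum; last by move=> k; case: (H (enum_val k)).
rewrite [RHS](reindex _ (onW_bij _ (enum_val_bij _))) /=.
by apply: eq_bigr => k _; case: (H (enum_val k)).
Qed.

Hypothesis flat : forall i j a b x, S x ->
  'd_i (B j a b) x - 'd_j (B i a b) x
  + \sum_e (B i a e x * B j e b x - B j a e x * B i e b x) = 0.

Variable u0 : J -> R.

(** Starting from 0 rather than from [u0] makes the initial defect vanish and the first step equal
    to the constant [u0], so both geometric bounds have trivial base cases. The value at [c] is
    correct from the first step on. *)
Fixpoint picard k : J -> 'rV[R]_d -> R^o :=
  if k is k'.+1 then fun a x =>
    u0 a - radial_homotopy c 0 (fun j y => \sum_b B j a b y * picard k' b y) x
  else fun _ _ => 0.

Let D : R := \sum_a `|u0 a|.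
Let D_ge0 : 0 <= D. Proof. exact: sumr_ge0. Qed.

Lemma Ck_picard n k a : Ck n S (picard k a).
Proof.
elim: k a => [|k IH] a; first exact: Ck_cst.
apply: CkB => //; first exact: Ck_cst.
by apply: Ck_homotopy => j; exact: Ck_system.
Qed.

Lemma picard_step k a x : S x -> `|picard k.+1 a x - picard k a x| <= D * half k.
Proof.
elim: k a x => [|k IH] a x Sx.
  have H0 : radial_homotopy c 0 (fun j y => \sum_b B j a b y * picard 0 b y) x = 0.
    apply/eqP; rewrite -normr_le0 -[leRHS](mulr0 8%:R^-1).
    by apply: homotopy_system_bound => // [b|b y _]; [exact: Ck_cst|rewrite normr0].
  rewrite [picard 1 a x]/picard -/picard H0 !subr0 expr0 mulr1 /D (bigD1 a) //=.
  by rewrite lerDl sumr_ge0.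
rewrite [picard k.+2 a x]/= [picard k.+1 a x in X in _ - X]/=.
rewrite opprB addrC addrA subrK distrC -radial_homotopyB //; last 2 first.
- by move=> j; apply: Ck_system => b; exact: (Ck_picard 0 k.+1 b).
- by move=> j; apply: Ck_system => b; exact: Ck_picard.
rewrite (@eq_radial_homotopy _ _
  (fun j y => \sum_b B j a b y * (picard k.+1 b y - picard k b y))) //.
  apply: le_trans (homotopy_system_bound _ _ _ _ IH Sx) _.
  - by move=> b; apply: CkB => //; exact: Ck_picard.
  - by rewrite mulr_ge0 // half_ge0.
  - exact: half_contract.
by move=> j y Sy; rewrite -sumrB; apply: eq_bigr => b _; exact/esym/mulrBr.
Qed.

Definition defect k i a x : R^o :=
  'd_i (picard k a) x + \sum_b B i a b x * picard k b x.

(* [homotopy_FTC] for the component [al i] cancels the radial integral in the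
   derivative of the iterate; flatness turns what remains into defects. *)
Lemma defectS k i a x : S x -> defect k.+1 i a x =
  radial_homotopy c 1 (fun j y => \sum_e (B i a e y * defect k j e y
    - B j a e y * defect k i e y)) x
  + \sum_b B i a b x * (picard k.+1 b x - picard k b x).
Proof.
move=> Sx; set al := fun j y => \sum_b B j a b y * picard k b y : R^o.
have Cal n j : Ck n S (al j) by apply: Ck_system => b; exact: Ck_picard.
have E : 'd_i (picard k.+1 a) x = - 'd_i (radial_homotopy c 0 al) x.
  have d2 : derivable (radial_homotopy c 0 al) x (delta_mx 0 i) :=
    Ck1_derivable (Ck_homotopy 0 (Cal 1%N)) Sx.
  apply: (etrans (deriveB (derivable_cst (u0 a : R^o) x _) d2)).
  by rewrite derive_cst sub0r.
rewrite /defect E (derive_homotopy 0 i (Cal 1%N) Sx).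
have -> : \sum_b B i a b x * picard k.+1 b x =
    al i x + \sum_b B i a b x * (picard k.+1 b x - picard k b x).
  rewrite /al -big_split; apply: eq_bigr => b _; move: (picard k.+1) => v.
  by rewrite /= mulrBr subrKC.
rewrite addrA; congr (_ + _).
rewrite (homotopy_FTC 0 (Cal 1%N i) Sx) mul1r opprD addrACA addNr add0r addrC.
rewrite -radial_homotopyB //; last 2 first.
- by move=> j; exact: (Cal 1%N i).2.
- by move=> j; exact: (Cal 1%N j).2.
apply: eq_radial_homotopy => // j y Sy.
rewrite !derive_system //; try (by move=> b; exact: Ck_picard).
rewrite /defect -sumrB.
transitivity (\sum_b (('d_j (B i a b) y - 'd_i (B j a b) y) * picard k b y
   + (B i a b y * 'd_j (picard k b) y - B j a b y * 'd_i (picard k b) y))).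
  by apply: eq_bigr => b _; rewrite mulrBl opprD addrACA.
rewrite big_split /=.
(* Flatness replaces the antisymmetrized derivatives of [B] by commutators. After exchanging the
   sums, these complete the derivatives of the iterate to defects. *)
transitivity (\sum_b \sum_e (B i a e y * B j e b y - B j a e y * B i e b y) * picard k b y
  + \sum_b (B i a b y * 'd_j (picard k b) y - B j a b y * 'd_i (picard k b) y)).
  congr (_ + _); apply: eq_bigr => b _; rewrite -mulr_suml; congr (_ * _).
  have := flat i j a b Sy; move/eqP; rewrite addrC addr_eq0 opprB => /eqP ->.
  by [].
rewrite exchange_big -big_split; apply: eq_bigr => e _ /=.
rewrite !mulrDr opprD [RHS]addrACA [RHS]addrC; congr (_ + _).
rewrite !mulr_sumr -sumrB; apply: eq_bigr => b _.
by rewrite mulrBl !mulrA.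
Qed.

(** Chosen so that the contribution [N * M * D] of the Picard step is exactly the quarter allotted
    to it in [quarter_sum]. *)
Let Y : R := 4%:R * (N * M * D).
Let Y_ge0 : 0 <= Y. Proof. by rewrite !mulr_ge0. Qed.

Lemma defect_bound k i a x : S x -> `|defect k i a x| <= Y * half k.
Proof.
elim: k i a x => [|k IH] i a x Sx.
  rewrite /defect big1 => [|b _]; last by rewrite mulr0.
  by rewrite addr0 (derive_cst (0 : R^o)) normr0 mulr_ge0 ?half_ge0.
have C0d j e : Ck 0 S (defect k j e).
  apply: CkD => //; first exact: (Ck_picard 1 k e).2.
  by apply: Ck_system => b; exact: Ck_picard.
rewrite defectS //; apply: le_trans (ler_normD _ _) _.
have H1 : `|radial_homotopy c 1 (fun j y => \sum_e (B i a e y * defect k j e y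
    - B j a e y * defect k i e y)) x| <= d%:R * r * (N * M * (Y * half k) + N * M * (Y * half k)).
  apply: homotopy_bound => // [j|j y Sy].
    by apply: Ck_sum => // e _; apply: CkB => //; apply: CkM => //; exact: CB.
  rewrite sumrB; apply: le_trans (ler_normB _ _) _.
  by apply: lerD; apply: system_bound => // b; exact: IH.
have H2 : `|\sum_b B i a b x * (picard k.+1 b x - picard k b x)| <= N * M * (D * half k).
  apply: (@system_bound i a (fun b x => picard k.+1 b x - picard k b x)) => // b.
  exact: picard_step.
apply: le_trans (lerD H1 H2) _.
have H3 := ler_wpM2r (mulr_ge0 Y_ge0 (half_ge0 k)) small.
have NMD : N * M * D = Y / 4%:R by rewrite /Y; field.
have -> : N * M * (D * half k) = (Y * half k) / 4%:R by rewrite mulrA NMD; ring.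
have -> : Y * half k.+1 = (Y * half k) / 2%:R by rewrite exprS; ring.
move: H3; set t := Y * half k; set q := d%:R * r * (N * M).
have -> : d%:R * r * (N * M * t + N * M * t) = 2%:R * (q * t) by rewrite /q; ring.
exact: quarter_sum.
Qed.

Lemma picard_center k a : picard k.+1 a c = u0 a.
Proof. by rewrite /= /radial_homotopy big1 ?subr0 // => j _; rewrite subrr mxE mul0r. Qed.

(** Limits are chosen point by point, with default 0 off the ball; the bound does not depend on [x],
    which is what makes the convergence uniform. *)
Lemma picard_limit : exists u : J -> 'rV[R]_d -> R^o,
  forall a x, S x -> forall k, `|u a x - picard k a x| <= 2 * D * half k.
Proof.
have H a x : exists l, S x -> forall k, `|l - picard k a x| <= 2 * D * half k.
  have [Sx|nSx] := pselect (S x); last by exists 0.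
  have [l lP] := @geometric_limit R (fun k => picard k a x) D
    (fun k => picard_step k a Sx).
  by exists l.
exists (fun a x => projT1 (cid (H a x))) => a x.
exact: (projT2 (cid (H a x))).
Qed.

Section PicardLimit.
Variable u : J -> 'rV[R]_d -> R^o.
Hypothesis uP : forall a x, S x -> forall k, `|u a x - picard k a x| <= 2 * D * half k.

Lemma limit_center a : u a c = u0 a.
Proof.
apply/eqP; rewrite -subr_eq0 -normr_le0; apply: (@le_addr_half _ _ 0 (2 * D)) => k.
rewrite add0r -(picard_center k); apply: le_trans (uP _ (ballxx _ r_gt0) _) _.
rewrite ler_wpM2l ?mulr_ge0 // exprS -[leRHS]mul1r ler_wpM2r ?half_ge0 //.
by rewrite invf_le1 // ler1n.
Qed.

Lemma limit_continuous a : Ck 0 S (u a).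
Proof.
move=> x Sx; apply/(@cvgrPdist_le _ _ _ (nbhs x)) => e e0.
have e4 : 0 < e / 4%:R by rewrite divr_gt0.
have [k kP] := half_small (2 * D) e4.
have e2 : 0 < e / 2%:R by rewrite divr_gt0.
have Cp : Ck 0 S (picard k a) := Ck_picard 0 k a.
have /(@cvgrPdist_le _ _ _ (nbhs x))/(_ _ e2) nP := Cp x Sx.
have nS : \forall y \near x, S y by exact: open_nbhs_nbhs.
move: nP nS; apply: filterS2 => y Hy Sy.
have -> : u a x - u a y = (u a x - picard k a x) + (picard k a x - picard k a y)
  - (u a y - picard k a y) by ring.
have -> : e = e / 4%:R + e / 2%:R + e / 4%:R by field.
apply: le_trans (ler_normB _ _) _; apply: lerD; last exact: le_trans (uP _ Sy k) kP.
apply: le_trans (ler_normD _ _) _; apply: lerD; last exact: Hy.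
exact: le_trans (uP _ Sx k) kP.
Qed.

(** The derivatives of the iterates are not shown to converge beforehand. The mean value theorem is
    applied to an iterate, whose derivative is [- B u] up to the defect and the distance to the
    limit; both errors are multiples of 2^-k, and what stays is the oscillation of [F] near [x]. *)
Lemma limit_differentiable a x : S x -> differentiable (u a) x /\
  forall v, 'D_v (u a) x = \sum_i v 0 i * (- \sum_b B i a b x * u b x).
Proof.
move=> Sx; apply: differentiable_coordsP => e e0.
pose F i y : R^o := \sum_b B i a b y * u b y.
have CF i : Ck 0 S (F i) by apply: Ck_system => b; exact: limit_continuous.
have e'0 : 0 < e / d.+1%:R by rewrite divr_gt0.
have nS : \forall y \near x, S y by exact: open_nbhs_nbhs.
have nF : \forall y \near x, forall i : 'I_d, `|F i x - F i y| <= e / d.+1%:R.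
  apply: (@filter_forall _ _ (fun i y => `|F i x - F i y| <= e / d.+1%:R) (nbhs x)) => i.
  by have /(@cvgrPdist_le _ _ _ (nbhs x))/(_ _ e'0) := CF i x Sx.
have : \forall y \near x, S y /\ forall i, `|F i x - F i y| <= e / d.+1%:R.
  by move: nS nF; apply: filterS2 => y.
move=> /nbhs_ballP[delta /= delta0 H]; apply/nbhs_ballP; exists delta => //= y xy.
have bs s : 0 <= s <= 1 -> ball x delta (x + s *: (y - x)).
  move=> s01; apply: (ball_segment s01 _ xy).
  by rewrite ball_norm_subr subrr normr0.
have [Sy _] := H _ xy.
pose Z := Y + N * M * (2 * D).
apply: (@le_trans _ _ (\sum_(i < d) `|y - x| * (e / d.+1%:R))); last first.
  have H1 : e / d.+1%:R * d%:R <= e.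
    by rewrite -mulrA ger_pMr // ler_pdivrMl // mulr1 ler_nat.
  by rewrite sumr_const card_ord -[leLHS]mulr_natr -mulrA mulrC ler_wpM2r.
(* The ball around [x] was fixed before [k]. The intermediate point [z] varies with [k] but stays in
   that ball, so the estimate [zF] holds along the whole limit. *)
apply: (@le_addr_half _ _ _ (2 * D + 2 * D + \sum_(i < d) `|y - x| * Z)) => k.
have [|s s01] := @mvt_line R d (picard k a) x (y - x).
  by move=> s s01; apply: (Ck_picard 1 k a).1; have [] := H _ (bs s s01).
rewrite subrKC; set z := x + _; have [Sz zF] := H _ (bs s s01).
rewrite derive_coord; last exact: (Ck_picard 1 k a).1.
move=> mvt.
have -> : u a y - u a x - \sum_j (y - x) 0 j * - F j x =
  (u a y - picard k a y) - (u a x - picard k a x) +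
  \sum_j (y - x) 0 j * ('d_j (picard k a) z + F j x).
  have -> : \sum_j (y - x) 0 j * ('d_j (picard k a) z + F j x) =
     picard k a y - picard k a x - \sum_j (y - x) 0 j * - F j x.
    rewrite mvt -sumrB; apply: eq_bigr => j _.
    by rewrite mulrN opprK mulrDr.
  by ring.
rewrite mulrDl addrCA.
apply: le_trans (ler_normD _ _) _; apply: lerD.
  rewrite mulrDl; apply: le_trans (ler_normB _ _) _; apply: lerD; exact: uP.
rewrite mulr_suml -big_split /=; apply: le_trans (ler_norm_sum _ _ _) _.
apply: ler_sum => j _; rewrite normrM -mulrA -mulrDr.
apply: ler_pM => //; first exact: ler_norm_coord.
have -> : 'd_j (picard k a) z + F j x = (F j x - F j z) + (defect k j a z +
    \sum_b B j a b z * (u b z - picard k b z)).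
  have -> : F j z = \sum_b B j a b z * picard k b z +
      \sum_b B j a b z * (u b z - picard k b z).
    by rewrite -big_split; apply: eq_bigr => b _; rewrite /= mulrBr subrKC.
  by rewrite /defect; ring.
apply: le_trans (ler_normD _ _) _; apply: lerD; first exact: zF.
rewrite mulrDl; apply: le_trans (ler_normD _ _) _; apply: lerD.
  exact: defect_bound.
rewrite -mulrA; apply: (@system_bound j a (fun b z => u b z - picard k b z)) => // b.
exact: uP.
Qed.

Lemma Ck_limit k a : Ck k S (u a).
Proof.
elim: k a => [|k IH] a; first exact: limit_continuous.
split=> [x Sx|v]; first by have [] := limit_differentiable a Sx.
apply: (@Ck_eq _ _ _ _ _ (fun x => \sum_i v 0 i * (- \sum_b B i a b x * u b x))) => //.
  by move=> x Sx; have [_ ->] := limit_differentiable a Sx.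
apply: Ck_sum => // i _; apply: CkZ => //; apply: CkN => //.
by apply: Ck_system.
Qed.

End PicardLimit.

Lemma system_solution : exists u : J -> 'rV[R]_d -> R^o,
  [/\ forall a, u a c = u0 a, forall k a, Ck k S (u a) &
  forall i a x, S x -> 'd_i (u a) x = - \sum_b B i a b x * u b x].
Proof.
have [u uP] := picard_limit; exists u; split.
- exact: limit_center.
- by move=> k a; exact: Ck_limit.
- move=> i a x Sx; have [_ ->] := limit_differentiable uP a Sx.
  rewrite (bigD1 i) //= !mxE !eqxx mul1r [X in _ + X]big1 ?addr0 // => j ij.
  by rewrite !mxE (negbTE ij) andbF mul0r.
Qed.

End LinearSystem.

(** * Functions with values in finite-dimensional spaces *)

Section VectorValued.
Context {R : realType} {d : nat}.
Implicit Types (V W X : vectType R) (U : set 'rV[R]_d).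

(* The coordinates in which smooth_fun and pderiv differentiate. *)
Definition CkV V k U (f : 'rV[R]_d -> V) := Ck k U (fun y => v2r (f y)).

Definition vderive V (v : 'rV[R]_d) (f : 'rV[R]_d -> V) (x : 'rV[R]_d) : V :=
  r2v ('D_v (fun y => v2r (f y)) x).

Lemma functionalE V (F : V -> R^o) (w : V) : linear F ->
  F w = \sum_j v2r w 0 j * F (r2v (delta_mx 0 j)).
Proof.
move=> linF; pose FM := GRing.isLinear.Build R _ _ _ F linF.
pose FL : {linear V -> R^o} := HB.pack F FM.
rewrite -[w in LHS]v2rK [v2r w in LHS]row_sum_delta linear_sum.
rewrite -[F]/(FL : V -> R^o) linear_sum.
by apply: eq_bigr => j _; rewrite !linearZ.
Qed.

Lemma coordinate_linear V j : linear (fun w : V => v2r w 0 j : R^o).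
Proof. by move=> a u w; rewrite linearP !mxE. Qed.

Lemma Ck_functional V k U (f : 'rV[R]_d -> V) (F : V -> R^o) : open U -> linear F ->
  CkV k U f -> Ck k U (fun y => F (f y)).
Proof.
move=> oU linF Cf.
apply: (@Ck_eq _ _ _ _ _
  (fun y => \sum_j v2r (f y) 0 j * F (r2v (delta_mx 0 j)) : R^o)) => //.
  by move=> y _; rewrite -functionalE.
apply: Ck_sum => // j _; apply: CkM => //; last exact: Ck_cst.
by move/Ck_mxP : Cf; exact.
Qed.

Lemma derive_functional V U (f : 'rV[R]_d -> V) (F : V -> R^o) (v x : 'rV[R]_d) :
  linear F -> CkV 1 U f -> U x ->
  'D_v (fun y => F (f y)) x = F (vderive v f x).
Proof.
move=> linF [df _] Ux.
pose a j : R := F (r2v (delta_mx 0 j)).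
pose G (z : 'rV[R]_(dim V)) : R^o := \sum_j z 0 j * a j.
have HG z : differentiable G z /\ forall w, 'D_w G z = \sum_j w 0 j * a j.
  apply: differentiable_coordsP => e e0; apply/nbhs_ballP; exists 1 => //= y _.
  rewrite /G -!sumrB big1 ?normr0 ?(mulr_ge0 (ltW e0)) // => j _.
  by rewrite !mxE; ring.
have -> : (fun y => F (f y)) = G \o (fun y => v2r (f y)).
  by apply/funext => y /=; rewrite functionalE.
rewrite derive_compE; last 2 first.
- exact: df.
- by have [] := HG (v2r (f x)).
rewrite (functionalE _ linF) /vderive r2vK; apply: eq_bigr => j _.
have [_ ->] := HG (v2r (f x)).
rewrite (bigD1 j) //= !mxE !eqxx mul1r big1 ?addr0 // => k /negbTE kj.
by rewrite !mxE kj andbF mul0r.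
Qed.

Lemma CkVP V k U (f : 'rV[R]_d -> V) : open U ->
  (forall j, Ck k U (fun y => v2r (f y) 0 j : R^o)) <-> CkV k U f.
Proof.
move=> oU; split=> [H|Cf j]; last exact: (Ck_functional oU (coordinate_linear j)).
by apply/Ck_mxP => // i j; rewrite ord1.
Qed.

Lemma vderiveP V U (f : 'rV[R]_d -> V) (v x : 'rV[R]_d) (w : V) : CkV 1 U f -> U x ->
  (forall j, 'D_v (fun y => v2r (f y) 0 j : R^o) x = v2r w 0 j) ->
  vderive v f x = w.
Proof.
move=> Cf Ux H; apply: v2r_inj; apply/rowP => j.
by rewrite -H (derive_functional _ (coordinate_linear j) Cf Ux).
Qed.

Lemma CkV_eq V k U (f g : 'rV[R]_d -> V) : open U ->
  (forall x, U x -> f x = g x) -> CkV k U f -> CkV k U g.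
Proof. by move=> oU fg; apply: Ck_eq => // x Ux; rewrite fg. Qed.

Lemma CkV_subset V k U U' (f : 'rV[R]_d -> V) : U `<=` U' -> CkV k U' f -> CkV k U f.
Proof. exact: Ck_subset. Qed.

Lemma CkV_cst V k U (w : V) : CkV k U (fun=> w).
Proof. exact: Ck_cst. Qed.

Lemma CkVD V k U (f g : 'rV[R]_d -> V) : open U -> CkV k U f -> CkV k U g ->
  CkV k U (fun y => f y + g y).
Proof.
move=> oU Cf Cg; apply: Ck_eq (CkD oU Cf Cg) => // x _.
by rewrite linearD.
Qed.

Lemma CkV_sum V k U I (r : seq I) (P : pred I) (f : I -> 'rV[R]_d -> V) : open U ->
  (forall i, P i -> CkV k U (f i)) -> CkV k U (fun y => \sum_(i <- r | P i) f i y).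
Proof.
move=> oU Cf; apply: Ck_eq (Ck_sum r oU Cf) => // x _.
by rewrite linear_sum.
Qed.

Lemma eq_vderive V U (f g : 'rV[R]_d -> V) v x : open U -> U x ->
  (forall y, U y -> f y = g y) -> vderive v f x = vderive v g x.
Proof.
move=> oU Ux fg; congr r2v; apply: near_eq_derive.
by apply: filterS (open_nbhs_nbhs (conj oU Ux)) => y Uy; rewrite fg.
Qed.

Lemma vderive_cst V (w : V) v x : vderive v (fun=> w) x = 0.
Proof. by rewrite /vderive derive_cst linear0. Qed.

Lemma vderiveD V U (f g : 'rV[R]_d -> V) v x : CkV 1 U f -> CkV 1 U g -> U x ->
  vderive v (fun y => f y + g y) x = vderive v f x + vderive v g x.
Proof.
move=> Cf Cg Ux.
have df : derivable (fun y => v2r (f y)) x v := diff_derivable (Cf.1 x Ux).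
have dg : derivable (fun y => v2r (g y)) x v := diff_derivable (Cg.1 x Ux).
rewrite /vderive -linearD; congr r2v; apply: etrans (deriveD df dg).
by congr ('D_v _ x); apply/funext => y; rewrite linearD.
Qed.

Lemma vderive_sum V U (I : Type) (r : seq I) (f : I -> 'rV[R]_d -> V) v x : open U ->
  (forall i, CkV 1 U (f i)) -> U x ->
  vderive v (fun y => \sum_(i <- r) f i y) x = \sum_(i <- r) vderive v (f i) x.
Proof.
move=> oU Cf Ux; elim: r => [|i r IH].
  rewrite big_nil; apply: etrans (vderive_cst (0 : V) v x).
  congr (vderive v _ x); apply/funext => y; exact: big_nil.
rewrite big_cons -IH.
apply: etrans (vderiveD v (Cf i) (CkV_sum r oU (fun j _ => Cf j)) Ux).
congr (vderive v _ x); apply/funext => y; exact: big_cons.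
Qed.

Section Bilinear.
Variables (V W X : vectType R) (b : V -> W -> X).
Hypothesis bl : forall g, linear (b ^~ g).
Hypothesis br : forall f, linear (b f).

Lemma bilinear_coordinate f g j :
  v2r (b f g) 0 j = \sum_i v2r f 0 i * v2r (b (r2v (delta_mx 0 i)) g) 0 j.
Proof.
apply: (functionalE (F := fun f => v2r (b f g) 0 j : R^o)) => a u w.
by rewrite bl linearP !mxE.
Qed.

Let linF i j : linear (fun g => v2r (b (r2v (delta_mx 0 i)) g) 0 j : R^o).
Proof. by move=> a u w; rewrite br linearP !mxE. Qed.

Lemma CkV_bilinear k U f g : open U -> CkV k U f -> CkV k U g ->
  CkV k U (fun y => b (f y) (g y)).
Proof.
move=> oU Cf Cg; apply/CkVP => // j.
apply: (@Ck_eq _ _ _ _ _ (fun y => \sum_i v2r (f y) 0 i *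
   v2r (b (r2v (delta_mx 0 i)) (g y)) 0 j : R^o)) => //.
  by move=> y _; rewrite -bilinear_coordinate.
apply: Ck_sum => // i _; apply: CkM => //; first exact: (CkVP k f oU).2.
exact: (Ck_functional oU (linF i j)).
Qed.

(** One Leibniz rule for real multiples of vectors and for products in [K]. A coordinate of
    [b (f y) (g y)] is a finite sum of products of scalar functions, which reduces it to the real
    rule. *)
Lemma vderive_bilinear U f g v x : open U -> CkV 1 U f -> CkV 1 U g -> U x ->
  vderive v (fun y => b (f y) (g y)) x =
  b (vderive v f x) (g x) + b (f x) (vderive v g x).
Proof.
move=> oU Cf Cg Ux; apply: (vderiveP (CkV_bilinear oU Cf Cg) Ux) => j.
pose p i (y : 'rV[R]_d) : R^o := v2r (f y) 0 i.
pose q i (y : 'rV[R]_d) : R^o := v2r (b (r2v (delta_mx 0 i)) (g y)) 0 j.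
have H i : is_derive x v (p i * q i) (p i x * v2r (b (r2v (delta_mx 0 i)) (vderive v g x)) 0 j
    + q i x * v2r (vderive v f x) 0 i).
  have d1 : derivable (p i) x v.
    by apply: (Ck1_derivable (U := U) (k := 0)) => //; exact: (CkVP 1 f oU).2.
  have d2 : derivable (q i) x v.
    apply: (Ck1_derivable (U := U) (k := 0)) => //.
    exact: (Ck_functional oU (linF i j)).
  apply: DeriveDef; first exact: derivableM.
  rewrite deriveM // (derive_functional _ (linF i j) Cg Ux).
  by rewrite (derive_functional _ (coordinate_linear i) Cf Ux).
have -> : (fun y => v2r (b (f y) (g y)) 0 j : R^o) = \sum_i (p i * q i).
  by apply/funext => y; rewrite fct_sumE bilinear_coordinate.
rewrite derive_sum; last by move=> i; case: (H i).
rewrite linearD mxE !(bilinear_coordinate _ _ j) -big_split.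
apply: eq_bigr => i _; case: (H i) => _ ->.
by rewrite addrC; congr (_ + _); rewrite mulrC.
Qed.

End Bilinear.

End VectorValued.

(** * Flat systems near a point, real and over [K] *)

Section Frobenius.
Context {R : realType} {d : nat}.
Implicit Types (c x : 'rV[R]_d) (rho : R).
Local Notation "''d_' j f" := ('D_(delta_mx 0 j) f) (at level 10, j, f at next level).

(** The bound [M] is fixed first, from the values at the centre plus a margin 1; shrinking the
    radius afterwards preserves it. *)
Lemma small_ball (J : finType) c rho (B : 'I_d -> J -> J -> 'rV[R]_d -> R^o) :
  0 < rho -> (forall i a b, Ck 0 (ball c rho) (B i a b)) ->
  exists r M : R, [/\ 0 < r, r <= rho, 0 <= M,
    (forall i a b x, ball c r x -> `|B i a b x| <= M) &
    d%:R * r * (#|J|%:R * M) <= 8%:R^-1].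
Proof.
move=> rho0 CB.
pose M := \sum_(t : 'I_d * J * J) `|B t.1.1 t.1.2 t.2 c| + 1.
have M0 : 0 <= M by rewrite addr_ge0 // sumr_ge0.
have : \forall x \near c, forall t : 'I_d * J * J, `|B t.1.1 t.1.2 t.2 x| <= M.
  apply: (@filter_forall _ _
    (fun (t : 'I_d * J * J) x => `|B t.1.1 t.1.2 t.2 x| <= M) (nbhs c)) => t.
  have Cc : {for c, continuous (B t.1.1 t.1.2 t.2)} by apply: CB; exact: ballxx.
  have /(@cvgrPdist_le _ _ _ (nbhs c))/(_ 1 ltr01) := Cc.
  apply: filterS => x H; rewrite -(subrK (B t.1.1 t.1.2 t.2 c) (B _ _ _ x)).
  apply: le_trans (ler_normD _ _) _; rewrite addrC /M; apply: lerD; last by rewrite distrC.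
  by rewrite (bigD1 t) //= lerDl sumr_ge0.
move=> /nbhs_ballP[delta /= delta0 H].
(* The inverse of [L] is a small enough radius; the summand 1 keeps [L] positive when [d], [J] or
   [M] is zero. *)
pose L : R := 8%:R * (d%:R * (#|J|%:R * M) + 1).
have L0 : 0 < L by rewrite mulr_gt0 // ltr_wpDl // !mulr_ge0.
exists (Num.min (Num.min delta rho) L^-1), M; split=> //.
- by rewrite !lt_min delta0 rho0 invr_gt0.
- by rewrite !ge_min lexx orbT.
- move=> i a b x xr; apply: (H x _ (i, a, b)).
  by apply: le_ball xr; rewrite !ge_min lexx.
- apply: (@le_trans _ _ (d%:R * L^-1 * (#|J|%:R * M))).
    rewrite ler_wpM2r ?mulr_ge0 // ler_wpM2l //.
    by rewrite ge_min lexx orbT.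
  rewrite mulrAC /L invfM mulrCA ger_pMr ?invr_gt0 // ler_pdivrMr ?ltr_wpDl ?mulr_ge0 //.
  by rewrite mul1r lerDl.
Qed.

(** The smallness condition concerns [B] alone, so one radius serves all initial values [u0]; this
    allows the columns of a fundamental matrix to live on a common ball. *)
Lemma frobenius (J : finType) c rho (B : 'I_d -> J -> J -> 'rV[R]_d -> R^o) :
  0 < rho -> (forall k i a b, Ck k (ball c rho) (B i a b)) ->
  (forall i j a b x, ball c rho x ->
    'd_i (B j a b) x - 'd_j (B i a b) x
    + \sum_e (B i a e x * B j e b x - B j a e x * B i e b x) = 0) ->
  exists r, [/\ 0 < r, r <= rho & forall u0 : J -> R,
    exists u : J -> 'rV[R]_d -> R^o,
    [/\ forall a, u a c = u0 a, forall k a, Ck k (ball c r) (u a) &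
    forall i a x, ball c r x -> 'd_i (u a) x = - \sum_b B i a b x * u b x]].
Proof.
move=> rho0 CB fl; have [r [M [r0 rrho M0 BM sm]]] := small_ball rho0 (CB 0%N).
have sub : ball c r `<=` ball c rho by exact: le_ball.
exists r; split=> // u0; apply: (@system_solution R d J c r B M) => //.
- by move=> k i a b; apply: Ck_subset sub _; exact: CB.
- by move=> i j a b x /sub; exact: fl.
Qed.

(** Only local, because the contraction argument needs a bound on [w], obtained near [c] from
    continuity, and a small radius. *)
Lemma frobenius_unique (J : finType) c rho (B : 'I_d -> J -> J -> 'rV[R]_d -> R^o)
    (w : J -> 'rV[R]_d -> R^o) :
  0 < rho -> (forall k i a b, Ck k (ball c rho) (B i a b)) ->
  (forall a, Ck 1 (ball c rho) (w a)) -> (forall a, w a c = 0) ->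
  (forall i a x, ball c rho x -> 'd_i (w a) x = - \sum_b B i a b x * w b x) ->
  \forall x \near c, forall a, w a x = 0.
Proof.
move=> rho0 CB Cw w0 dw.
have : \forall x \near c, forall a, `|w a x| <= 1.
  apply: (@filter_forall _ _ (fun a x => `|w a x| <= 1) (nbhs c)) => a.
  have Cc : {for c, continuous (w a)} by apply: (Ck_continuous (Cw a)); exact: ballxx.
  have /(@cvgrPdist_le _ _ _ (nbhs c))/(_ 1 ltr01) := Cc.
  by apply: filterS => x; rewrite w0 sub0r normrN.
move=> /nbhs_ballP[delta /= delta0 H].
pose s := Num.min delta rho.
have s0 : 0 < s by rewrite lt_min delta0.
have sub0 : ball c s `<=` ball c rho by apply: le_ball; rewrite ge_min lexx orbT.
have CBs k i a b : Ck k (ball c s) (B i a b) by apply: Ck_subset sub0 _; exact: CB.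
have [r [M [r0 rs M0 BM sm]]] := small_ball s0 (CBs 0%N).
have sub : ball c r `<=` ball c s by exact: le_ball.
apply/nbhs_ballP; exists r => //= x xr a.
apply: (@system_unique R d J c r B M r0 _ BM sm w 1) => //.
- by move=> k i b e; apply: Ck_subset sub _; exact: CBs.
- by move=> b; apply: Ck_subset (Cw b) => y /sub/sub0.
- by move=> i b y /sub/sub0; exact: dw.
- by move=> b y /sub yr; apply: H; apply: le_ball yr; rewrite ge_min lexx.
Qed.

End Frobenius.

Section FieldValuedFrobenius.
Context {R : realType} {K : fieldExtType R} {d r : nat}.
Variables (c : 'rV[R]_d) (rho : R) (B : 'I_d -> 'I_r -> 'I_r -> 'rV[R]_d -> K).
Local Notation S := (ball c rho).
Local Notation "''d_' j f" := (vderive (delta_mx 0 j) f) (at level 10, j, f at next level).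
Local Notation m := (dim K).
Local Notation J := ('I_r * 'I_m)%type.
Local Notation e_ q := (r2v (delta_mx 0 q) : K).
Let oS : open S := ball_open _ _.
Hypothesis rho_gt0 : 0 < rho.
Hypothesis CB : forall k i a b, CkV k S (B i a b).

Let linl p (z : K) : linear (fun w : K => v2r (w * z) 0 p : R^o).
Proof. by move=> a u w; rewrite mulrDl -scalerAl linearP !mxE. Qed.

Let linr p (z : K) : linear (fun w : K => v2r (z * w) 0 p : R^o).
Proof. by move=> a u w; rewrite mulrDr -scalerAr linearP !mxE. Qed.

(* The action of B on K^r as a real matrix. *)
Let T i (a b : J) y : R^o := v2r (B i a.1 b.1 y * e_ b.2) 0 a.2.

Let CT k i a b : Ck k S (T i a b).
Proof. exact: (Ck_functional oS (linl a.2 _) (CB k _ _ _)). Qed.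

(** Acting by the real matrix on coordinates is multiplying by [z] over [K]. Applied to the columns
    of [T] it also computes products of real matrices, so the flatness condition carries over. *)
Lemma real_action (z : 'I_r -> K) (u : J -> R) p :
  \sum_e v2r (z e.1 * e_ e.2) 0 p * u e =
  v2r (\sum_b z b * r2v (\row_q u (b, q))) 0 p.
Proof.
transitivity (\sum_b \sum_q v2r (z b * e_ q) 0 p * u (b, q)).
  by rewrite pair_big; apply: eq_bigr => -[b q].
rewrite linear_sum summxE.
apply: eq_bigr => b _; rewrite (functionalE _ (linr p (z b))).
by apply: eq_bigr => q _; rewrite r2vK mxE mulrC.
Qed.

Lemma frobenius_field :
  (forall i j a b x, S x -> 'd_i (B j a b) x - 'd_j (B i a b) x
    + \sum_e (B i a e x * B j e b x - B j a e x * B i e b x) = 0) ->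
  exists s, [/\ 0 < s, s <= rho & exists g : 'I_r -> 'I_r -> 'rV[R]_d -> K,
    [/\ forall a b, g a b c = (a == b)%:R, forall k a b, CkV k (ball c s) (g a b) &
    forall i a b x, ball c s x -> 'd_i (g a b) x = - \sum_e B i a e x * g e b x]].
Proof.
move=> flat; have [||s [s0 srho H]] := @frobenius R d J c rho T rho_gt0.
- exact: CT.
- move=> i j a b x Sx; rewrite /T !(derive_functional _ (linl _ _) (CB 1%N _ _ _) Sx).
  rewrite sumrB (real_action (fun f => B i a.1 f x) (fun e => T j e b x) a.2).
  rewrite (real_action (fun f => B j a.1 f x) (fun e => T i e b x) a.2) /T.
  have E k f : r2v (\row_q v2r (B k (f, q).1 b.1 x * e_ b.2) 0 (f, q).2) = B k f b.1 x * e_ b.2.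
    by apply: v2r_inj; rewrite r2vK; apply/rowP => q; rewrite mxE.
  under [X in _ + (v2r X _ _ - _)]eq_bigr do rewrite E mulrA.
  under [X in _ + (_ - v2r X _ _)]eq_bigr do rewrite E mulrA.
  rewrite -!mulr_suml.
  (* The flatness expression for [T] is the image under this linear form of the one for [B]. *)
  pose F (w : K) : R^o := v2r (w * e_ b.2) 0 a.2.
  transitivity (F ('d_i (B j a.1 b.1) x - 'd_j (B i a.1 b.1) x
    + \sum_e (B i a.1 e x * B j e b.1 x - B j a.1 e x * B i e b.1 x))).
    by rewrite sumrB /F !(mulrDl, mulNr) !(linearD, linearN) !mxE.
  by rewrite flat // /F mul0r linear0 mxE.
exists s; split=> //.
(* Column [b] starts at the b-th unit vector of K^r in real coordinates, which makes [g] the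
   identity at the centre. *)
pose u0 (b : 'I_r) (e : J) : R := v2r ((e.1 == b)%:R : K) 0 e.2.
have {}H b := cid (H (u0 b)).
pose u b := sval (H b).
have sub : ball c s `<=` S by exact: le_ball.
have oB : open (ball c s) := ball_open _ _.
pose g a b y : K := r2v (\row_q u b (a, q) y).
have gE a b y q : v2r (g a b y) 0 q = u b (a, q) y by rewrite r2vK mxE.
have Cg k a b : CkV k (ball c s) (g a b).
  apply/CkVP => // q; rewrite (_ : (fun y => _) = u b (a, q)); last first.
    by apply/funext => y; rewrite gE.
  by have [_ Cu _] := svalP (H b); exact: Cu.
exists g; split=> // [a b|i a b x Sx].
  apply: v2r_inj; apply/rowP => q; rewrite gE.
  by have [E0 _ _] := svalP (H b); rewrite /u E0.
apply: (vderiveP (Cg 1%N a b) Sx) => q.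
rewrite (_ : (fun y => _) = u b (a, q)); last by apply/funext => y; rewrite gE.
have [_ _ E1] := svalP (H b); rewrite {1}/u E1 // -/(u b).
by rewrite (real_action (fun e => B i a e x) (u b ^~ x)) linearN mxE.
Qed.

Lemma frobenius_field_unique (w : 'I_r -> 'rV[R]_d -> K) :
  (forall a, CkV 1 S (w a)) -> (forall a, w a c = 0) ->
  (forall i a x, S x -> 'd_i (w a) x = - \sum_b B i a b x * w b x) ->
  \forall x \near c, forall a, w a x = 0.
Proof.
move=> Cw w0 dw.
pose u (e : J) y : R^o := v2r (w e.1 y) 0 e.2.
have : \forall x \near c, forall e, u e x = 0.
  apply: (@frobenius_unique R d J c rho T u rho_gt0 CT).
  - by move=> e; exact: (CkVP _ _ oS).2.
  - by move=> e; rewrite /u w0 linear0 mxE.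
  - move=> i a x Sx; rewrite /u (derive_functional _ (coordinate_linear a.2) (Cw a.1) Sx).
    rewrite dw // (real_action (fun b => B i a.1 b x) (u ^~ x)) linearN mxE; congr (- v2r _ _ _).
    apply: eq_bigr => b _; congr (_ * _).
    by apply: v2r_inj; rewrite r2vK; apply/rowP => q; rewrite mxE.
apply: filterS => x H a; apply: v2r_inj; apply/rowP => q.
by have := H (a, q); rewrite /u /= => ->; rewrite linear0 mxE.
Qed.

End FieldValuedFrobenius.

Section FieldCalculus.
Context {R : realType} {d : nat}.
Implicit Types (U : set 'rV[R]_d) (v x : 'rV[R]_d).

(** The coordinate isomorphism of the line [R^o] is not assumed to be the identity; it multiplies by
    the constant coordinate of 1, which does not affect smoothness. *)
Lemma CkV_real k U (f : 'rV[R]_d -> R^o) : open U -> CkV k U f <-> Ck k U f.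
Proof.
move=> oU; split=> [|Cf].
  by apply: (Ck_functional (F := fun w : R^o => w) oU) => a u w.
apply/CkVP => // j.
apply: (@Ck_eq _ _ _ _ _ (fun y => f y * v2r (1 : R^o) 0 j : R^o)) => //.
  by move=> y _; rewrite -[f y in RHS]mulr1 -[f y * 1]/(f y *: (1 : R^o)) linearZ mxE.
by apply: CkM => //; exact: Ck_cst.
Qed.

Lemma vderive_real U (f : 'rV[R]_d -> R^o) v x : open U -> Ck 1 U f -> U x ->
  vderive v f x = 'D_v f x.
Proof.
move=> oU Cf Ux.
have := derive_functional (F := fun w : R^o => w) v _ ((CkV_real 1 f oU).2 Cf) Ux.
by move=> ->.
Qed.

Section Scale.
Variable V : vectType R.
Let bl (g : V) : linear (fun f : R^o => f *: g).
Proof. by move=> a u w; rewrite scalerDl scalerA. Qed.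
Let br (f : R^o) : linear (fun g : V => f *: g).
Proof. by move=> a u w; rewrite scalerDr !scalerA mulrC. Qed.

Lemma CkVZ k U (f : 'rV[R]_d -> R^o) (g : 'rV[R]_d -> V) : open U ->
  Ck k U f -> CkV k U g -> CkV k U (fun y => f y *: g y).
Proof.
by move=> oU /(CkV_real k f oU).2 Cf Cg; exact: (CkV_bilinear bl br oU Cf Cg).
Qed.

Lemma vderiveZ U (f : 'rV[R]_d -> R^o) (g : 'rV[R]_d -> V) v x : open U ->
  Ck 1 U f -> CkV 1 U g -> U x ->
  vderive v (fun y => f y *: g y) x = 'D_v f x *: g x + f x *: vderive v g x.
Proof.
move=> oU Cf Cg Ux; rewrite -(vderive_real v oU Cf Ux).
exact: (vderive_bilinear bl br v oU ((CkV_real 1 f oU).2 Cf) Cg Ux).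
Qed.

Lemma CkVN k U (g : 'rV[R]_d -> V) : open U ->
  CkV k U g -> CkV k U (fun y => - g y).
Proof.
move=> oU Cg; apply: CkV_eq (CkVZ oU (@Ck_cst _ _ _ k U (-1 : R^o)) Cg) => // y _.
by rewrite scaleN1r.
Qed.

Lemma CkVB k U (f g : 'rV[R]_d -> V) : open U ->
  CkV k U f -> CkV k U g -> CkV k U (fun y => f y - g y).
Proof. by move=> oU Cf Cg; apply: CkVD => //; exact: CkVN. Qed.

Lemma vderiveB U (f g : 'rV[R]_d -> V) v x : open U ->
  CkV 1 U f -> CkV 1 U g -> U x ->
  vderive v (fun y => f y - g y) x = vderive v f x - vderive v g x.
Proof.
move=> oU Cf Cg Ux.
apply: etrans (vderiveD v Cf (CkVN oU Cg) Ux) _; congr (_ + _).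
rewrite (eq_vderive (g := fun y => (fun=> -1 : R^o) y *: g y) v oU Ux); last first.
  by move=> y _; rewrite scaleN1r.
apply: etrans (vderiveZ v oU (@Ck_cst _ _ _ 1 U (-1 : R^o)) Cg Ux) _.
by rewrite derive_cst scale0r add0r scaleN1r.
Qed.

End Scale.

Section Product.
Variable K : fieldExtType R.
Let bl (g : K) : linear (fun f : K => f * g).
Proof. by move=> a u w; rewrite mulrDl -scalerAl. Qed.
Let br (f : K) : linear (fun g : K => f * g).
Proof. by move=> a u w; rewrite mulrDr -scalerAr. Qed.

Lemma CkVM k U (f g : 'rV[R]_d -> K) : open U ->
  CkV k U f -> CkV k U g -> CkV k U (fun y => f y * g y).
Proof. exact: (CkV_bilinear bl br). Qed.

Lemma vderiveM U (f g : 'rV[R]_d -> K) v x : open U ->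
  CkV 1 U f -> CkV 1 U g -> U x ->
  vderive v (fun y => f y * g y) x = vderive v f x * g x + f x * vderive v g x.
Proof. exact: (vderive_bilinear bl br). Qed.

Lemma CkV_prod k U I (s : seq I) (f : I -> 'rV[R]_d -> K) : open U ->
  (forall i, CkV k U (f i)) -> CkV k U (fun y => \prod_(i <- s) f i y).
Proof.
move=> oU Cf; elim: s => [|i s IH].
  by apply: CkV_eq (CkV_cst k U (1 : K)) => // y _; rewrite big_nil.
by apply: CkV_eq (CkVM oU (Cf i) IH) => // y _; rewrite big_cons.
Qed.

Lemma CkV_det k U r (f : 'I_r -> 'I_r -> 'rV[R]_d -> K) : open U ->
  (forall a b, CkV k U (f a b)) -> CkV k U (fun y => \det (\matrix_(a, b) f a b y)).
Proof.
move=> oU Cf; apply: (@CkV_eq _ _ _ _ _ (fun y => \sum_(s : 'S_r)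
    (-1) ^+ s * \prod_a f a (s a) y)) => //.
  move=> y _; apply: eq_bigr => s _; congr (_ * _).
  by apply: eq_bigr => a _; rewrite mxE.
apply: CkV_sum => // s _; apply: CkVM => //; first exact: CkV_cst.
exact: CkV_prod.
Qed.

End Product.

End FieldCalculus.

(** * The parallel frame in coordinates *)

Section LocalGauge.
Context {R : realType} {K : fieldExtType R} {d r : nat}.
Variables (c : 'rV[R]_d) (rho : R).
Variables (A : 'I_d -> 'I_r -> 'I_r -> 'rV[R]_d -> K).
Variables (phi : 'I_r -> 'I_r -> 'rV[R]_d -> K).
Variables (w : 'I_d -> 'I_d -> 'rV[R]_d -> R^o).
Local Notation S := (ball c rho).
Local Notation "''d_' j f" := (vderive (delta_mx 0 j) f) (at level 10, j, f at next level).
Hypothesis rho_gt0 : 0 < rho.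
Hypothesis CA : forall k i a b, CkV k S (A i a b).
Hypothesis Cphi : forall k a b, CkV k S (phi a b).
Hypothesis Cw : forall k i j, Ck k S (w i j).
Hypothesis w_anti : forall i j x, S x -> w i j x = - w j i x.
Hypothesis w_closed : forall i j k x, S x ->
  'D_(delta_mx 0 i) (w j k) x + 'D_(delta_mx 0 j) (w k i) x
  + 'D_(delta_mx 0 k) (w i j) x = 0.
Hypothesis A_curv : forall i j a b x, S x ->
  'd_i (A j a b) x - 'd_j (A i a b) x
  + \sum_e (A i a e x * A j e b x - A j a e x * A i e b x) = w i j x *: phi a b x.
Hypothesis phi_parallel : forall i a b x, S x ->
  'd_i (phi a b) x + \sum_e (A i a e x * phi e b x - phi a e x * A i e b x) = 0.

(* Subtracting [l phi] makes the connection flat: the terms in which phi is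
   differentiated cancel the commutators of A with phi, and [dl = w] cancels
   the curvature. *)
Lemma local_gauge : exists s (l : 'I_d -> 'rV[R]_d -> R^o)
    (g : 'I_r -> 'I_r -> 'rV[R]_d -> K) (C : 'I_r -> 'I_r -> K),
  [/\ 0 < s /\ s <= rho, (forall k i, Ck k (ball c s) (l i)) /\
    (forall i j x, ball c s x ->
      'D_(delta_mx 0 i) (l j) x - 'D_(delta_mx 0 j) (l i) x = w i j x),
    (forall k a b, CkV k (ball c s) (g a b)) /\
    (forall x, ball c s x -> \det (\matrix_(a, b) g a b x) != 0),
    (forall i a b x, ball c s x -> 'd_i (g a b) x + \sum_e A i a e x * g e b x =
      l i x *: \sum_e g a e x * C e b) &
    forall a b x, ball c s x -> \sum_e phi a e x * g e b x = \sum_e g a e x * C e b].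
Proof.
have oS : open S := ball_open _ _.
have [l [Cl dl]] := poincare2 Cw w_anti w_closed.
pose B i a b y := A i a b y - l i y *: phi a b y.
have Clp k i a b : CkV k S (fun y => l i y *: phi a b y) by apply: CkVZ.
have CB k i a b : CkV k S (B i a b) by apply: CkVB.
have dB i j a b x : S x -> 'd_i (B j a b) x =
    'd_i (A j a b) x - (('D_(delta_mx 0 i) (l j) x)%:A * phi a b x
      + (l j x)%:A * 'd_i (phi a b) x).
  rewrite !mulr_algl => Sx; apply: etrans (vderiveB (delta_mx 0 i) oS (CA 1 j a b) (Clp 1%N j a b) Sx) _.
  congr (_ - _).
  exact: (vderiveZ (delta_mx 0 i) oS (Cl 1%N j) (Cphi 1 a b) Sx).
have BE i a b x : B i a b x = A i a b x - (l i x)%:A * phi a b x.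
  by rewrite /B mulr_algl.
have flat i j a b x : S x -> 'd_i (B j a b) x - 'd_j (B i a b) x
    + \sum_e (B i a e x * B j e b x - B j a e x * B i e b x) = 0.
  move=> Sx; rewrite !dB //.
  have dphi k : 'd_k (phi a b) x = - \sum_e (A k a e x * phi e b x - phi a e x * A k e b x).
    by apply/eqP; rewrite -addr_eq0 phi_parallel.
  (* The terms quadratic in [phi] carry the symmetric factor [l i x * l j x] and cancel; only
     commutators of [A] with [A] and with [phi] remain. *)
  have -> : \sum_e (B i a e x * B j e b x - B j a e x * B i e b x) =
     \sum_e (A i a e x * A j e b x - A j a e x * A i e b x)
     - (l j x)%:A * \sum_e (A i a e x * phi e b x - phi a e x * A i e b x)
     + (l i x)%:A * \sum_e (A j a e x * phi e b x - phi a e x * A j e b x).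
    rewrite !mulr_sumr -sumrB -big_split; apply: eq_bigr => e _.
    by rewrite /= !BE; ring.
  rewrite !dphi; have := A_curv i j a b Sx; rewrite -dl // scalerBl.
  rewrite -!(mulr_algl _ (phi a b x)).
  set X := \sum_e _; set Yi := \sum_e _; set Yj := \sum_e _ => H.
  have -> : X = ('D_(delta_mx 0 i) (l j) x)%:A * phi a b x -
     ('D_(delta_mx 0 j) (l i) x)%:A * phi a b x - ('d_i (A j a b) x - 'd_j (A i a b) x).
    by rewrite -H addrAC subrr add0r.
  by ring.
have [s [s0 srho [g [g1 Cg dg]]]] := frobenius_field rho_gt0 CB flat.
have sub : ball c s `<=` S by exact: le_ball.
have oB : open (ball c s) := ball_open _ _.
have Bc : ball c s c by exact: ballxx.
(* Since [g] is the identity at the centre, this is the only candidate for [phi g = g C]. *)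
pose C a b := phi a b c.
(* Column [b] of [phi g - g C]. As [phi] commutes with the covariant derivative of [d + B] and [C]
   is constant, each column solves the system of [g] itself, with value 0 at [c]. *)
pose V b a y := \sum_e (phi a e y * g e b y - g a e y * C e b).
have Cpg k a e b : CkV k (ball c s) (fun y => phi a e y * g e b y).
  by apply: CkVM => //; apply: CkV_subset sub _; exact: Cphi.
have CgC k a e b : CkV k (ball c s) (fun y => g a e y * C e b).
  by apply: CkVM => //; exact: CkV_cst.
have CV b a : CkV 1 (ball c s) (V b a).
  by apply: CkV_sum => // e _; apply: CkVB.
have V0 b a : V b a c = 0.
  rewrite /V sumrB; apply/eqP; rewrite subr_eq0 (bigD1 b) //= [X in _ + X]big1; last first.
    by move=> e /negbTE eb; rewrite g1 eb mulr0.
  rewrite [X in _ == X](bigD1 a) //= [X in _ == _ + X]big1.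
    by rewrite !g1 !eqxx mulr1 mul1r !addr0.
  by move=> e /negbTE eb; rewrite g1 eq_sym eb mul0r.
have dV b i a x : ball c s x -> 'd_i (V b a) x = - \sum_e B i a e x * V b e x.
  move=> Sx; have Sx' := sub x Sx.
  pose Ai := \matrix_(a, b) A i a b x; pose P := \matrix_(a, b) phi a b x.
  pose G := \matrix_(a, b) g a b x; pose CC := \matrix_(a, b) C a b.
  have mxN (X : 'M[K]_r) a' b' : (- X) a' b' = - X a' b' by rewrite mxE.
  pose Bi := Ai - (l i x)%:A *: P.
  have BiE a' b' : B i a' b' x = Bi a' b'.
    by rewrite !mxE BE.
  have dP a' b' : 'd_i (phi a' b') x = - (Ai *m P - P *m Ai) a' b'.
    apply/eqP; rewrite -addr_eq0 -[X in _ == X](phi_parallel i a' b' Sx') !mxE -sumrB.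
    by apply/eqP; congr (_ + _); apply: eq_bigr => e _; rewrite !mxE.
  have dG a' b' : 'd_i (g a' b') x = - (Bi *m G) a' b'.
    rewrite dg // !mxE; congr (- _); apply: eq_bigr => e _.
    by rewrite BiE [G _ _]mxE.
  transitivity (((- (Ai *m P - P *m Ai)) *m G + P *m (- (Bi *m G)) - (- (Bi *m G)) *m CC) a b).
    rewrite /V (vderive_sum _ _ oB) //; last by move=> e; apply: CkVB.
    rewrite !mxE -big_split -sumrB; apply: eq_bigr => e _ /=.
    apply: etrans (vderiveB (delta_mx 0 i) oB (Cpg 1%N a e b) (CgC 1%N a e b) Sx) _.
    congr (_ - _).
      apply: etrans (vderiveM (delta_mx 0 i) oB (CkV_subset sub (Cphi 1 a e)) (Cg 1%N e b) Sx) _.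
      by rewrite dP dG !mxN ![G _ _]mxE ![P _ _]mxE.
    apply: etrans (vderiveM (delta_mx 0 i) oB (Cg 1%N a e) (CkV_cst 1 _ (C e b)) Sx) _.
    by rewrite vderive_cst mulr0 addr0 dG !mxN ![CC _ _]mxE.
  transitivity ((- (Bi *m (P *m G - G *m CC))) a b); last first.
    rewrite !mxE; congr (- _); apply: eq_bigr => e _; rewrite BiE; congr (_ * _).
    by rewrite !mxE -sumrB; apply: eq_bigr => f _; rewrite !mxE.
  congr (fun_of_matrix _ a b).
  rewrite /Bi !(mulmxBl, mulmxBr, mulNmx, mulmxN) -!scalemxAl !mulmxA.
  rewrite -!scalemxAr !mulmxA -?scalemxAl.
  (* The identity is linear in these five triple products, so they can be generalized and no
     noncommutative algebra is left. *)
  move: (Ai *m P *m G) (P *m Ai *m G) (P *m P *m G) (Ai *m G *m CC) (P *m G *m CC).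
  move=> X1 X2 X3 X4 X5; apply/matrixP => a' b'; rewrite !mxE; ring.
have nV b : \forall x \near c, forall a, V b a x = 0.
  apply: (@frobenius_field_unique _ _ _ _ c s B s0) => //.
  - by move=> k i a e; apply: CkV_subset sub _; exact: CB.
  - exact: dV.
(* The determinant is 1 at the centre and continuous, so [g] stays invertible nearby. *)
have nD : \forall x \near c, \det (\matrix_(a, b) g a b x) != 0.
  pose f y := v2r (\det (\matrix_(a, b) g a b y)).
  have cf : {for c, continuous f} by apply: (CkV_det oB (Cg 0%N)).
  have fc : f c != 0.
    rewrite /f; have -> : \matrix_(a, b) g a b c = 1%:M by apply/matrixP => i j; rewrite !mxE g1.
    by rewrite det1 -(linear0 (@v2r _ K)) (inj_eq (@v2r_inj _ K)) oner_eq0.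
  have nf : \forall x \near c, f x != 0 := cvgr_neq0 (FF := nbhs_filter c) (f c) cf fc.
  move: nf; apply: filterS => x; apply: contraNneq => dx0.
  by rewrite /f dx0 linear0.
have nVa : \forall x \near c, forall b a, V b a x = 0.
  exact: (@filter_forall _ _ (fun b x => forall a, V b a x = 0) (nbhs c) (nbhs_filter c) nV).
have : \forall x \near c, (forall b a, V b a x = 0) /\ \det (\matrix_(a, b) g a b x) != 0.
  by move: nVa nD; apply: filterS2 => x.
move=> /nbhs_ballP[delta /= delta0 H].
pose t := Num.min delta s.
have t0 : 0 < t by rewrite lt_min delta0.
have ts : t <= s by rewrite ge_min lexx orbT.
have subt : ball c t `<=` ball c s by exact: le_ball.
have subd : ball c t `<=` ball c delta by apply: le_ball; rewrite ge_min lexx.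
have pgE a b x : ball c t x -> \sum_e phi a e x * g e b x = \sum_e g a e x * C e b.
  move=> xt; apply/eqP; rewrite -subr_eq0 -sumrB; apply/eqP.
  exact: (H x (subd x xt)).1.
exists t, l, g, C; split=> //.
- by split=> //; exact: le_trans ts srho.
- split=> [k i|i j x /subt/sub]; last exact: dl.
  by apply: Ck_subset (Cl k i) => x /subt/sub.
- split=> [k a b|x /subd/H[]//]; exact: CkV_subset subt (Cg k a b).
- move=> i a b x xt; rewrite dg; last exact: subt.
  rewrite -pgE // scaler_sumr addrC -sumrB; apply: eq_bigr => e _.
  by rewrite /B mulrBl opprB addrC subrK scalerAl.
Qed.

End LocalGauge.

(** * Changes of charts *)

Section Composition.
Context {R : realType} {d : nat}.
Implicit Types (U W : set 'rV[R]_d) (p : 'rV[R]_d -> 'rV[R]_d).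
Local Notation e_ mu := (delta_mx 0 mu : 'rV[R]_d).

Lemma CkV_comp (V : vectType R) k U W (f : 'rV[R]_d -> V) p : open U -> open W ->
  (forall x, U x -> W (p x)) -> Ck k U p -> CkV k W f -> CkV k U (f \o p).
Proof.
move=> oU oW UW Cp Cf; apply/CkVP => // j.
exact: (Ck_comp (f := fun y => v2r (f y) 0 j : R^o) oU UW Cp ((CkVP k f oW).2 Cf j)).
Qed.

Lemma vderive_comp (V : vectType R) U W (f : 'rV[R]_d -> V) p v x : open U -> open W ->
  (forall x, U x -> W (p x)) -> Ck 1 U p -> CkV 1 W f -> U x ->
  vderive v (f \o p) x = \sum_nu ('D_v p x) 0 nu *: vderive (e_ nu) f (p x).
Proof.
move=> oU oW UW Cp Cf Ux; apply: (vderiveP (CkV_comp oU oW UW Cp Cf) Ux) => j.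
have Cj := (CkVP 1 f oW).2 Cf j.
apply: etrans (derive_compE v (f := fun y => v2r (f y) 0 j : R^o) (Cp.1 x Ux) (Cj.1 _ (UW x Ux))) _.
rewrite linear_sum summxE; apply: eq_bigr => nu _; rewrite linearZ mxE.
by rewrite (derive_functional _ (coordinate_linear j) Cf (UW x Ux)).
Qed.

(** The algebra behind d(p^* l) = p^* dl: [P] stands for the first and [H] for the second
    derivatives of the map, and the symmetry of [H] removes it. *)
Lemma antisymmetrized_product (P : 'I_d -> 'I_d -> R) (L : 'I_d -> R)
    (H : 'I_d -> 'I_d -> 'I_d -> R) (DL : 'I_d -> 'I_d -> R) mu nu :
  (forall rho, H mu nu rho = H nu mu rho) ->
  \sum_rho (P nu rho * (\sum_sigma P mu sigma * DL sigma rho) + L rho * H mu nu rho)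
  - \sum_rho (P mu rho * (\sum_sigma P nu sigma * DL sigma rho) + L rho * H nu mu rho) =
  \sum_rho \sum_sigma P mu rho * P nu sigma * (DL rho sigma - DL sigma rho).
Proof.
move=> sH; rewrite !big_split /= opprD addrACA.
rewrite [X in _ + X](_ : _ = 0) ?addr0; last first.
  by apply/eqP; rewrite subr_eq0; apply/eqP; apply: eq_bigr => rho _; rewrite sH.
under [X in X - _]eq_bigr do rewrite mulr_sumr.
rewrite exchange_big /= -sumrB; apply: eq_bigr => rho _.
rewrite mulr_sumr -sumrB; apply: eq_bigr => sigma _.
by ring.
Qed.

(** Here [q] is the pullback of [l] along [p]. Its derivatives contain second derivatives of [p],
    which cancel by [derive_swap]; hence two orders of differentiability of [p]. *)
Lemma ext_deriv_pullback U W (l : 'I_d -> 'rV[R]_d -> R^o) p mu nu x :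
  open U -> open W -> (forall x, U x -> W (p x)) -> Ck 2 U p ->
  (forall rho, Ck 1 W (l rho)) -> U x ->
  let q mu y := \sum_rho 'D_(e_ mu) (fun z => p z 0 rho : R^o) y * l rho (p y) : R^o in
  'D_(e_ mu) (q nu) x - 'D_(e_ nu) (q mu) x =
  \sum_rho \sum_sigma
    'D_(e_ mu) (fun z => p z 0 rho : R^o) x * 'D_(e_ nu) (fun z => p z 0 sigma : R^o) x *
    ('D_(e_ rho) (l sigma) (p x) - 'D_(e_ sigma) (l rho) (p x)).
Proof.
move=> oU oW UW Cp Cl Ux q.
have Cpr rho : Ck 2 U (fun z => p z 0 rho : R^o) by move/Ck_mxP : Cp; exact.
have Clp rho : Ck 1 U (l rho \o p) by apply: (Ck_comp oU UW (Ck_leS Cp) (Cl rho)).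
have dq a b : 'D_(e_ a) (q b) x = \sum_rho (
    'D_(e_ b) (fun z => p z 0 rho : R^o) x *
      \sum_sigma 'D_(e_ a) (fun z => p z 0 sigma : R^o) x * 'D_(e_ sigma) (l rho) (p x)
    + l rho (p x) * 'D_(e_ a) ('D_(e_ b) (fun z => p z 0 rho : R^o)) x).
  pose P rho : 'rV[R]_d -> R^o := 'D_(e_ b) (fun z => p z 0 rho : R^o).
  have d1 rho : derivable (P rho) x (e_ a) := diff_derivable (((Cpr rho).2 (e_ b)).1 x Ux).
  have d2 rho : derivable (l rho \o p) x (e_ a) := diff_derivable ((Clp rho).1 x Ux).
  have -> : q b = \sum_rho (P rho * (l rho \o p)).
    by apply/funext => y; rewrite fct_sumE.
  rewrite derive_sum; last by move=> rho; exact: derivableM.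
  apply: eq_bigr => rho _; apply: etrans (deriveM (d1 rho) (d2 rho)) _.
  congr (_ + _); congr (_ * _).
  apply: etrans (derive_compE _ (Cp.1 x Ux) ((Cl rho).1 _ (UW x Ux))) _.
  by apply: eq_bigr => sigma _; rewrite derive_mxE //; exact: Cp.1.
apply: etrans (congr2 (fun a b => a - b) (dq mu nu) (dq nu mu)) _.
have sH rho : 'D_(e_ mu) ('D_(e_ nu) (fun z => p z 0 rho : R^o)) x =
    'D_(e_ nu) ('D_(e_ mu) (fun z => p z 0 rho : R^o)) x.
  exact: (derive_swap _ _ oU Ux (Cpr rho)).
exact: (@antisymmetrized_product (fun a rho => 'D_(e_ a) (fun z => p z 0 rho : R^o) x)
  (fun rho => l rho (p x)) (fun a b rho => 'D_(e_ a) ('D_(e_ b) (fun z => p z 0 rho : R^o)) x)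
  (fun sigma rho => 'D_(e_ sigma) (l rho) (p x)) mu nu sH).
Qed.

End Composition.

Local Notation jacobian := Defs.jacobian.

Section Charts.
Context {R : realType} {d : nat} {M : manifold R d}.
Implicit Types (i j : atlas M) (U W : set M) (V : vectType R).
Local Notation e_ mu := (delta_mx 0 mu : 'rV[R]_d).

Lemma chart_imageP i U y : U `<=` chart_dom i -> (chart i @` U) y ->
  U (chart_inv i y) /\ chart i (chart_inv i y) = y.
Proof. by move=> Ui [x Ux <-]; rewrite chartK //; exact: Ui. Qed.

Lemma open_chart_image i U : open U -> U `<=` chart_dom i -> open (chart i @` U).
Proof.
move=> oU Ui; rewrite openE => _ [x Ux <-].
have n1 : nbhs (chart i x) (chart i @` chart_dom i).
  apply: open_nbhs_nbhs; split; first exact: chart_image_open.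
  by exists x => //; exact: Ui.
have n2 : nbhs (chart i x) (chart_inv i @^-1` U).
  apply: (chart_inv_continuous (Ui x Ux)); rewrite chartK; last exact: Ui.
  exact: open_nbhs_nbhs.
move: n1 n2; rewrite /interior; apply: filterS2 => y [x' ix' <-] /= .
by rewrite chartK // => Ux'; exists x'.
Qed.

Lemma open_chart_preimage i (B : set 'rV[R]_d) : open B ->
  open (chart_dom i `&` chart i @^-1` B).
Proof.
move=> oB; rewrite openE => x [ix Bx]; apply: filterI.
  by apply: open_nbhs_nbhs; split => //; exact: chart_dom_open.
by apply: (chart_continuous ix); exact: open_nbhs_nbhs.
Qed.

Definition transition i j (y : 'rV[R]_d) : 'rV[R]_d := chart j (chart_inv i y).

Lemma Ck_transition k i j U : U `<=` chart_dom i `&` chart_dom j ->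
  Ck k (chart i @` U) (transition i j).
Proof. by move=> Uij; apply: Ck_subset (chart_smooth i j k); exact: image_subset. Qed.

Lemma smooth_fun_subset V U W (f : M -> V) : U `<=` W -> smooth_fun W f -> smooth_fun U f.
Proof.
move=> UW sf i k; apply: Ck_subset (sf i k); apply: image_subset.
by move=> x [Ux ix]; split=> //; exact: UW.
Qed.

Lemma openIchart i U : open U -> open (chart i @` (U `&` chart_dom i)).
Proof.
move=> oU; apply: open_chart_image; last by move=> x [].
by apply: openI => //; exact: chart_dom_open.
Qed.

Lemma smooth_fun_eq V U (f g : M -> V) : open U -> (forall x, U x -> f x = g x) ->
  smooth_fun U f -> smooth_fun U g.
Proof.
move=> oU fg sf i k.
have H : CkV k (chart i @` (U `&` chart_dom i)) (f \o chart_inv i) := sf i k.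
change (CkV k (chart i @` (U `&` chart_dom i)) (g \o chart_inv i)).
apply: CkV_eq H => [|y]; first exact: openIchart.
by move=> /chart_imageP[x []//|[? _] _]; exact: fg.
Qed.

Lemma smooth_fun_CkV V i U (f : M -> V) k : U `<=` chart_dom i -> smooth_fun U f ->
  CkV k (chart i @` U) (f \o chart_inv i).
Proof.
move=> Ui sf; apply: CkV_subset (sf i k); apply: image_subset => x Ux.
by split=> //; exact: Ui.
Qed.

(** In another chart the function is its expression in chart [i] composed with a smooth transition
    map. *)
Lemma smooth_fun_chart V i U (f : M -> V) : open U -> U `<=` chart_dom i ->
  (forall k, CkV k (chart i @` U) (f \o chart_inv i)) -> smooth_fun U f.
Proof.
move=> oU Ui Cf j k.
have oW := @openIchart j _ oU; have oUi := open_chart_image oU Ui.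
have sub : U `&` chart_dom j `<=` chart_dom j by move=> x [].
apply: (@CkV_eq _ _ _ _ _ ((f \o chart_inv i) \o transition j i)) => //.
  move=> y /(chart_imageP sub)[[Uy jy] yE] /=.
  by rewrite /transition chartK //; exact: Ui.
apply: (CkV_comp oW oUi) => //.
  by move=> y /(chart_imageP sub)[[Uy jy] yE]; exists (chart_inv j y).
by apply: Ck_transition => x [Ux jx]; split=> //; exact: Ui.
Qed.

Lemma smooth_fun_sum V U I (s : seq I) (f : I -> M -> V) : open U ->
  (forall a, smooth_fun U (f a)) -> smooth_fun U (fun x => \sum_(a <- s) f a x).
Proof. by move=> oU sf i k; apply: CkV_sum => [|a _]; [exact: openIchart|exact: sf]. Qed.

Lemma smooth_funM (K : fieldExtType R) U (f g : M -> K) : open U ->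
  smooth_fun U f -> smooth_fun U g -> smooth_fun U (fun x => f x * g x).
Proof.
by move=> oU sf sg i k; apply: CkVM; [exact: openIchart|exact: sf|exact: sg].
Qed.

Lemma pderivE V i mu (f : M -> V) x :
  pderiv i mu f x = vderive (e_ mu) (f \o chart_inv i) (chart i x).
Proof. by []. Qed.

Lemma chart_coord_smooth i nu : smooth_fun (chart_dom i) (fun y => chart i y 0 nu : R^o).
Proof.
have oi := open_chart_image (@chart_dom_open _ _ M i) (@subset_refl _ (chart_dom i)).
apply: (smooth_fun_chart (i := i)) => // [|k]; first exact: chart_dom_open.
apply/CkV_real => //; apply: (Ck_eq oi _ (@Ck_coord _ _ k _ nu)) => y.
by move=> /chart_imageP[//|_ /= ->].
Qed.

Lemma jacobianE i j mu nu x : chart_dom i x -> chart_dom j x ->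
  jacobian i j mu nu x = 'D_(e_ mu) (fun y => transition i j y 0 nu : R^o) (chart i x).
Proof.
move=> ix jx; set U := chart_dom i `&` chart_dom j.
have oU : open U by apply: openI; exact: chart_dom_open.
have oW : open (chart i @` U) by apply: open_chart_image => // y [].
apply: (vderive_real _ oW); last by exists x.
have C1 : Ck 1 (chart i @` U) (transition i j) by apply: Ck_transition.
by move/Ck_mxP: C1; exact.
Qed.

Lemma pderiv_chain V i j mu U (f : M -> V) x : open U -> smooth_fun U f ->
  U x -> chart_dom i x -> chart_dom j x ->
  pderiv i mu f x = \sum_nu jacobian i j mu nu x *: pderiv j nu f x.
Proof.
move=> oU sf Ux ix jx; pose W := U `&` (chart_dom i `&` chart_dom j).
have oW : open W by do 2?apply: openI => //; exact: chart_dom_open.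
have Wi : W `<=` chart_dom i by move=> y [_ []].
have Wj : W `<=` chart_dom j by move=> y [_ []].
have oi := open_chart_image oW Wi; have oj := open_chart_image oW Wj.
have Wx : (chart i @` W) (chart i x) by exists x.
have sfW : smooth_fun W f by apply: smooth_fun_subset sf => y [].
have Ct : Ck 1 (chart i @` W) (transition i j) by apply: Ck_transition => y [].
rewrite pderivE.
rewrite (eq_vderive (g := (f \o chart_inv j) \o transition i j) _ oi Wx); last first.
  by move=> y /(chart_imageP Wi)[[_ [_ jy]] _] /=; rewrite /transition chartK.
rewrite (vderive_comp _ oi oj _ Ct (smooth_fun_CkV 1 Wj sfW) Wx); last first.
  by move=> y /(chart_imageP Wi)[Wy _]; exists (chart_inv i y).
apply: eq_bigr => nu _; congr (_ *: _); last by rewrite pderivE /transition chartK.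
by apply: etrans (derive_mxE _ _ _ (Ct.1 _ Wx)) _; apply/esym/jacobianE.
Qed.

(** The chain rule [pderiv_chain] for the coordinate functions of the chart [k]. *)
Lemma jacobian_cocycle i j k mu nu x :
  chart_dom i x -> chart_dom j x -> chart_dom k x ->
  jacobian i k mu nu x = \sum_rho jacobian i j mu rho x * jacobian j k rho nu x.
Proof.
move=> ix jx kx.
exact: (pderiv_chain mu (chart_dom_open k) (@chart_coord_smooth k nu)).
Qed.

Section LocalForm.
Variables (i0 : atlas M) (U : set M) (l : 'I_d -> 'rV[R]_d -> R^o).
Hypothesis oU : open U.
Hypothesis U0 : U `<=` chart_dom i0.
Hypothesis Cl : forall k nu, Ck k (chart i0 @` U) (l nu).

(** A 1-form needs components in every chart, while [l] lives in [i0]; the transformation law forces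
    the others. *)
Definition local_form1 : components1 M := fun i mu x =>
  \sum_nu jacobian i i0 mu nu x * l nu (chart i0 x).

Let q i mu y : R^o :=
  \sum_nu 'D_(e_ mu) (fun z => transition i i0 z 0 nu : R^o) y * l nu (transition i i0 y).

Let oUi i : open (U `&` chart_dom i).
Proof. by apply: openI => //; exact: chart_dom_open. Qed.

Let sUi i : U `&` chart_dom i `<=` chart_dom i. Proof. by move=> y []. Qed.

Let local_form1_chart i mu y : (chart i @` (U `&` chart_dom i)) y ->
  (local_form1 i mu \o chart_inv i) y = q i mu y.
Proof.
move=> /(chart_imageP (@sUi i))[[Uy iy] yE]; apply: eq_bigr => nu _.
by rewrite jacobianE // ?yE //; exact: U0.
Qed.

Let transition_image i y : (chart i @` (U `&` chart_dom i)) y ->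
  (chart i0 @` U) (transition i i0 y).
Proof. by move=> /(chart_imageP (@sUi i))[[Uy iy] yE]; exists (chart_inv i y). Qed.

Let Ck_transition0 k i : Ck k (chart i @` (U `&` chart_dom i)) (transition i i0).
Proof. by apply: Ck_transition => y [Uy iy]; split=> //; exact: U0. Qed.

Lemma local_form1_form1 : form1 U local_form1.
Proof.
split=> [i mu|i j mu x Ux ix jx].
  have oW := @openIchart i _ oU.
  apply: (smooth_fun_chart (i := i)) => // k.
  apply: (CkV_eq oW (f := q i mu)) => [y Wy|]; first by rewrite -local_form1_chart.
  apply/CkV_real => //; apply: Ck_sum => // nu _; apply: CkM => //.
    (* The components contain first derivatives of the transition map, which costs one order. *)
    have /Ck_mxP : Ck k.+1 (chart i @` (U `&` chart_dom i)) (transition i i0) by [].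
    by move=> /(_ oW 0 nu)[_]; exact.
  exact: (Ck_comp oW (@transition_image i) (Ck_transition0 k i) (Cl k nu)).
have i0x := U0 Ux.
rewrite /local_form1; under [RHS]eq_bigr do rewrite mulr_sumr.
rewrite exchange_big; apply: eq_bigr => nu _ /=.
rewrite (jacobian_cocycle mu nu ix jx i0x) mulr_suml.
by apply: eq_bigr => rho _; rewrite mulrA.
Qed.

(** Exterior derivative commutes with the transition from [i] to [i0], and [w] obeys the matching
    tensor law, so the equation in the chart [i0] propagates to all charts. *)
Lemma ext_deriv_local_form1 (w : components2 M) : form2 setT w ->
  (forall mu nu x, U x -> 'D_(e_ mu) (l nu) (chart i0 x) - 'D_(e_ nu) (l mu) (chart i0 x)
    = w i0 mu nu x) ->
  forall i mu nu x, U x -> chart_dom i x -> ext_deriv1 local_form1 i mu nu x = w i mu nu x.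
Proof.
move=> [_ _ tw] dl i mu nu x Ux ix.
have oW := @openIchart i _ oU; have oU0 := open_chart_image oU U0.
have Wx : (chart i @` (U `&` chart_dom i)) (chart i x) by exists x.
have Cq b : Ck 1 (chart i @` (U `&` chart_dom i)) (q i b).
  have [sm _] := local_form1_form1.
  have H := smooth_fun_CkV 1 (@sUi i) (sm i b).
  exact: ((CkV_real 1 (q i b) oW).1 (CkV_eq oW (@local_form1_chart i b) H)).
have E a b : pderiv i a (local_form1 i b) x = 'D_(e_ a) (q i b) (chart i x).
  rewrite pderivE (eq_vderive (g := q i b) _ oW Wx); last exact: local_form1_chart.
  exact: (vderive_real _ oW (Cq b) Wx).
rewrite /ext_deriv1 !E.
apply: etrans (ext_deriv_pullback mu nu oW oU0 (@transition_image i)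
  (Ck_transition0 2 i) (Cl 1) Wx) _.
rewrite (tw i i0 mu nu x I ix (U0 Ux)).
apply: eq_bigr => rho _; apply: eq_bigr => sigma _.
have i0x := U0 Ux.
by rewrite !jacobianE // /transition chartK // dl.
Qed.

End LocalForm.

End Charts.

(** * Bundles and connections *)

Section Frames.
Context {K : fieldType} {V : vectType K} {r : nat}.
Variable s : 'I_r -> V.
Hypothesis s_basis : basis_of fullv [tuple s k | k < r].

Lemma frame_expand v : v = \sum_k coord [tuple s m | m < r] k v *: s k.
Proof.
rewrite {1}(coord_basis s_basis (memvf v)); apply: eq_bigr => k _.
by rewrite -tnth_nth tnth_mktuple.
Qed.

Lemma frame_coord z m : coord [tuple s k | k < r] m (\sum_k z k *: s k) = z m.
Proof.
rewrite -[RHS](coord_sum_free z m (basis_free s_basis)); congr coord.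
by apply: eq_bigr => k _; rewrite -tnth_nth tnth_mktuple.
Qed.

Lemma frame_inj y z : \sum_k y k *: s k = \sum_k z k *: s k -> forall m, y m = z m.
Proof. by move=> yz m; rewrite -(frame_coord y) yz frame_coord. Qed.

(** The inverse matrix recovers [s], so the new family spans; the dimension count gives
    independence. *)
Lemma frame_change (G : 'M[K]_r) : \det G != 0 ->
  basis_of fullv [tuple \sum_l G l k *: s l | k < r].
Proof.
move=> G0; have uG : G \in unitmx by rewrite unitmxE unitfE.
rewrite basisEdim size_tuple (size_basis s_basis) leqnn andbT.
set e := [tuple _ | _ < r].
have se l : s l = \sum_k invmx G k l *: tnth e k.
  transitivity (\sum_m (G *m invmx G) m l *: s m).
    rewrite mulmxV // (bigD1 l) //= mxE eqxx scale1r big1 ?addr0 // => m /negbTE ml.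
    by rewrite mxE ml scale0r.
  under [RHS]eq_bigr do rewrite tnth_mktuple scaler_sumr.
  rewrite exchange_big; apply: eq_bigr => m _ /=.
  by rewrite mxE scaler_suml; apply: eq_bigr => k _; rewrite scalerA mulrC.
apply/subvP => v _; rewrite (frame_expand v); apply: memv_suml => l _.
apply: memvZ; rewrite se; apply: memv_suml => k _; apply: memvZ.
by apply: memv_span; exact: mem_tnth.
Qed.

End Frames.

Section Connections.
Context {R : realType} {K : fieldExtType R} {d : nat} {M : manifold R d} {r : nat}.
Context {E : bundle K M r}.
Variable D : connection E.
Implicit Types (U W : set M) (i j : atlas M).

Lemma smooth_section_subset U W (s : section E) :
  U `<=` W -> smooth_section W s -> smooth_section U s.
Proof.
move=> UW ss a l; apply: smooth_fun_subset (ss a l) => x [Ux ax].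
by split=> //; exact: UW.
Qed.

Lemma smooth_section_comb U I (q : seq I) (f : I -> M -> K) (s : I -> section E) :
  open U -> (forall k, smooth_fun U (f k)) -> (forall k, smooth_section U (s k)) ->
  smooth_section U (fun x => \sum_(k <- q) f k x *: s k x).
Proof.
move=> oU sf ss a l.
have oUa : open (U `&` triv_dom a) by apply: openI => //; exact: triv_dom_open.
apply: (@smooth_fun_eq _ _ _ _ _ (fun x => \sum_(k <- q) f k x *
  coord [tuple triv a m x | m < r] l (s k x))) => //.
  by move=> x _; rewrite linear_sum; apply: eq_bigr => k _; rewrite linearZ.
apply: smooth_fun_sum => // k; apply: smooth_funM => //; last exact: ss.
by apply: smooth_fun_subset (sf k) => x [].
Qed.

Lemma nabla_comb U I (q : seq I) (f : I -> M -> K) (s : I -> section E) i mu x :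
  open U -> (forall k, smooth_fun U (f k)) -> (forall k, smooth_section U (s k)) ->
  U x -> chart_dom i x ->
  D (fun y => \sum_(k <- q) f k y *: s k y) i mu x =
  \sum_(k <- q) (pderiv i mu (f k) x *: s k x + f k x *: D (s k) i mu x).
Proof.
move=> oU sf ss Ux ix; elim: q => [|k q IH].
  have sz := smooth_section_comb [::] oU sf ss.
  (* The derivative of the zero section vanishes because it equals twice itself by additivity;
     [nabla_local] identifies the zero section with its double. *)
  rewrite big_nil; apply: (addrI (D (fun y => \sum_(k <- [::]) f k y *: s k y) i mu x)).
  rewrite addr0 -(nablaD D oU sz sz mu Ux ix); apply/esym.
  by apply: (nabla_local D oU sz _ mu Ux ix) => y _; rewrite !big_nil addr0.
have sq := smooth_section_comb q oU sf ss.
have sk : smooth_section U (fun y => f k y *: s k y).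
  have := smooth_section_comb [:: k] oU sf ss; congr smooth_section.
  by apply: functional_extensionality_dep => y; rewrite big_seq1.
rewrite big_cons -IH -(nabla_leibniz D oU (sf k) (ss k) mu Ux ix).
rewrite -(nablaD D oU sk sq mu Ux ix).
apply: (nabla_local D oU (smooth_section_comb _ oU sf ss) _ mu Ux ix) => y _.
exact: big_cons.
Qed.

Lemma triv_smooth_section (a : triv_atlas E) k : smooth_section (triv_dom a) (triv a k).
Proof.
by move=> b l; apply: smooth_fun_subset (triv_smooth b a k l) => x [? ?]; split.
Qed.

End Connections.

(** * From the coordinate ball back to the bundle *)

Section FlatFrame.
Context {R : realType} {K : fieldExtType R} {d : nat} {M : manifold R d} {r : nat}.
Context {E : bundle K M r}.
Variables (omega : components2 M) (D : connection E) (Phi : endomorphism E).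
Variables (i0 : atlas M) (a0 : triv_atlas E).
Hypothesis omega_form : form2 setT omega.
Hypothesis omega_closed : forall i mu nu rho x,
  chart_dom i x -> ext_deriv2 omega i mu nu rho x = 0.
Hypothesis Phi_flat : symplectically_flat omega D Phi.

Local Notation jacobian := Defs.jacobian.
Local Notation s := (triv a0).
Let W : set M := chart_dom i0 `&` triv_dom a0.
Let sc x m v : K := coord [tuple triv a0 k x | k < r] m v.
(** The connection matrix in the frame [s]. The last index names the section that is differentiated,
    so the matrix acts on columns of coordinates from the left; [phi] follows the same
    convention. *)
Let A mu m l x : K := sc m (D (s l) i0 mu x).
Let phi m l x : K := sc m (Phi x (s l x)).

Let oW : open W.
Proof. by apply: openI; [exact: chart_dom_open|exact: triv_dom_open]. Qed.

Let W0 : W `<=` chart_dom i0. Proof. by move=> x []. Qed.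
Let Wa : W `<=` triv_dom a0. Proof. by move=> x []. Qed.

Let s_smooth k : smooth_section W (s k).
Proof. exact: smooth_section_subset Wa (triv_smooth_section a0 k). Qed.

Let s_basis x : W x -> basis_of fullv [tuple s k x | k < r].
Proof. by move=> /Wa; exact: triv_basis. Qed.

Let Ds_smooth mu l : smooth_section W (D (s l) i0 mu).
Proof.
have [H _] := nabla_form1 D oW (s_smooth l).
by apply: smooth_section_subset (H i0 mu) => x Wx; split=> //; exact: W0.
Qed.

Let A_smooth mu m l : smooth_fun W (A mu m l).
Proof.
by apply: smooth_fun_subset (Ds_smooth mu l a0 m) => x Wx; split=> //; exact: Wa.
Qed.

Let Phi_smooth l : smooth_section W (fun x => Phi x (s l x)).
Proof. by case: Phi_flat => H _ _; apply: smooth_section_subset Wa (H a0 l). Qed.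

Let phi_smooth m l : smooth_fun W (phi m l).
Proof.
by apply: smooth_fun_subset (Phi_smooth l a0 m) => x Wx; split=> //; exact: Wa.
Qed.

Let DsE mu l x : W x -> D (s l) i0 mu x = \sum_m A mu m l x *: s m x.
Proof. by move=> Wx; exact: (frame_expand (s_basis Wx)). Qed.

Let PhisE l x : W x -> Phi x (s l x) = \sum_m phi m l x *: s m x.
Proof. by move=> Wx; exact: (frame_expand (s_basis Wx)). Qed.

Lemma nabla_frame U (f : 'I_r -> M -> K) mu x : open U -> U `<=` W ->
  (forall l, smooth_fun U (f l)) -> U x ->
  D (fun y => \sum_l f l y *: s l y) i0 mu x =
  \sum_m (pderiv i0 mu (f m) x + \sum_q A mu m q x * f q x) *: s m x.
Proof.
move=> oU UW sf Ux; have Wx := UW x Ux.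
have ss k : smooth_section U (s k) by exact: smooth_section_subset UW (s_smooth k).
rewrite (nabla_comb D _ mu oU sf ss Ux (W0 Wx)) big_split /=.
under [RHS]eq_bigr do rewrite scalerDl; rewrite [RHS]big_split /=; congr (_ + _).
under eq_bigr do rewrite (DsE _ _ Wx) scaler_sumr.
rewrite exchange_big; apply: eq_bigr => m _ /=; rewrite scaler_suml.
by apply: eq_bigr => q _; rewrite scalerA mulrC.
Qed.

(** The coordinates of [D (s l)] form a column of [A], so a second use of [nabla_frame] produces dA
    + A /\ A; comparing coordinates gives the curvature equation. *)
Let curvature_frame mu nu m l x : W x ->
  pderiv i0 mu (A nu m l) x - pderiv i0 nu (A mu m l) x
  + \sum_q (A mu m q x * A nu q l x - A nu m q x * A mu q l x)
  = omega i0 mu nu x *: phi m l x.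
Proof.
move=> Wx; case: Phi_flat => _ /(_ _ _ oW (s_smooth l) i0 mu nu x Wx (W0 Wx)) + _.
have DD a b : D (D (s l) i0 b) i0 a x =
    \sum_m (pderiv i0 a (A b m l) x + \sum_q A a m q x * A b q l x) *: s m x.
  rewrite -(@nabla_frame W) //.
  by apply: (nabla_local D oW (Ds_smooth b l) _ a Wx (W0 Wx)) => y; exact: DsE.
rewrite /curvature /nabla1 !DD (PhisE l Wx) scaler_sumr -sumrB => H.
apply: (frame_inj (s_basis Wx) (y := fun m => pderiv i0 mu (A nu m l) x - pderiv i0 nu (A mu m l) x
  + \sum_q (A mu m q x * A nu q l x - A nu m q x * A mu q l x))
  (z := fun m => omega i0 mu nu x *: phi m l x)).
apply: (etrans (etrans _ H)); apply: eq_bigr => k _.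
  by rewrite -scalerBl sumrB opprD addrACA.
by rewrite scalerA mulr_algl.
Qed.

(** [nabla_frame] on the columns of [phi] gives its derivative and [A phi]; expanding
    [Phi (D (s l))] gives [phi A]. *)
Let phi_frame mu m l x : W x ->
  pderiv i0 mu (phi m l) x
  + \sum_q (A mu m q x * phi q l x - phi m q x * A mu q l x) = 0.
Proof.
move=> Wx; case: Phi_flat => _ _ /(_ _ _ oW (s_smooth l) i0 mu x Wx (W0 Wx)).
have -> : nabla_end D Phi (s l) i0 mu x =
    D (fun y => \sum_m phi m l y *: s m y) i0 mu x - Phi x (D (s l) i0 mu x).
  congr (_ - _).
  by apply: (nabla_local D oW (Phi_smooth l) _ mu Wx (W0 Wx)) => y; exact: PhisE.
rewrite (@nabla_frame W) // (DsE mu l Wx) linear_sum /=.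
under [X in _ - X]eq_bigr do rewrite linearZ /= (PhisE _ Wx) scaler_sumr.
rewrite exchange_big -sumrB /= => H.
have {}H : \sum_k (pderiv i0 mu (phi k l) x
    + \sum_q (A mu k q x * phi q l x - phi k q x * A mu q l x)) *: s k x =
    \sum_k 0 *: s k x.
  rewrite [RHS]big1 => [|k _]; last by rewrite scale0r.
  rewrite -[RHS]H; apply: eq_bigr => k _.
  rewrite sumrB addrA scalerBl; congr (_ - _); rewrite scaler_suml.
  by apply: eq_bigr => q _; rewrite scalerA mulrC.
exact: (frame_inj (s_basis Wx) H m).
Qed.

Lemma flat_frame p : W p -> exists U : set M,
  [/\ open U, U p &
    exists (e : 'I_r -> section E) (C : 'M[K]_r) (lambda : components1 M),
      [/\ local_frame U e,
          represented_by U e Phi C,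
          form1 U lambda,
          forall i mu nu x, U x -> chart_dom i x ->
            ext_deriv1 lambda i mu nu x = omega i mu nu x &
          nabla_in_frame U e D C lambda]].
Proof.
move=> Wp; set c := chart i0 p.
have oW' := open_chart_image oW W0.
have /nbhs_ballP[rho /= rho0 sub] : nbhs c (chart i0 @` W).
  by apply: open_nbhs_nbhs; split=> //; exists p.
have inW y : ball c rho y -> W (chart_inv i0 y) /\ chart i0 (chart_inv i0 y) = y.
  by move=> /sub; exact: chart_imageP.
have oB t : open (ball c t) := ball_open _ _.
have Cw k mu nu : Ck k (chart i0 @` W) (omega i0 mu nu \o chart_inv i0).
  case: omega_form => H _ _; apply/CkV_real => //; apply: smooth_fun_CkV => //.
  by apply: smooth_fun_subset (H i0 mu nu) => x Wx; split=> //; exact: W0.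
have dw mu nu1 nu2 y : ball c rho y -> pderiv i0 mu (omega i0 nu1 nu2) (chart_inv i0 y) =
    'D_(delta_mx 0 mu) (omega i0 nu1 nu2 \o chart_inv i0) y.
  move=> By; have [_ yE] := inW y By; rewrite pderivE yE.
  exact: (vderive_real _ oW' (Cw 1%N nu1 nu2) (sub y By)).
have [|||||||t [l [g [C [[t0 trho] [Cl dl] [Cg dG] dg pg]]]]] :=
  @local_gauge R K d r c rho (fun mu m l => A mu m l \o chart_inv i0)
    (fun m l => phi m l \o chart_inv i0)
    (fun mu nu => omega i0 mu nu \o chart_inv i0) rho0.
- by move=> k mu m l; apply: CkV_subset sub _; exact: smooth_fun_CkV.
- by move=> k m l; apply: CkV_subset sub _; exact: smooth_fun_CkV.
- by move=> k mu nu; apply: Ck_subset sub _; exact: Cw.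
- move=> mu nu y /inW[Wy _] /=; case: omega_form => _ H _.
  by apply: H => //; exact: W0.
- move=> mu nu la y By; have [Wy _] := inW y By.
  by rewrite -!dw //; exact: (omega_closed mu nu la (W0 Wy)).
- move=> mu nu m k y /inW[Wy yE] /=.
  by have := curvature_frame mu nu m k Wy; rewrite !pderivE yE.
- move=> mu m k y /inW[Wy yE] /=.
  by have := phi_frame mu m k Wy; rewrite !pderivE yE.
pose U := W `&` (chart_dom i0 `&` chart i0 @^-1` ball c t).
have oU : open U by apply: openI => //; exact: open_chart_preimage.
have UW : U `<=` W by move=> x [].
have U0 : U `<=` chart_dom i0 by move=> x /UW/W0.
have Ut x : U x -> ball c t (chart i0 x) by move=> [_ []].
have imU : chart i0 @` U `<=` ball c t by move=> _ [x /Ut ? <-].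
have oU' := open_chart_image oU U0.
pose gM a b x := g a b (chart i0 x).
have gM_smooth a b : smooth_fun U (gM a b).
  apply: (smooth_fun_chart oU U0) => k.
  apply: (CkV_eq oU' _ (CkV_subset imU (Cg k a b))) => y.
  by move=> /(chart_imageP U0)[_ /= yE]; rewrite /gM yE.
(* The columns of [g] are the coordinates of the new frame vectors in the old frame. *)
pose e k : section E := fun x => \sum_a gM a k x *: s a x.
have ss k : smooth_section U (s k) by exact: smooth_section_subset UW (s_smooth k).
have e_smooth k : smooth_section U (e k) by exact: smooth_section_comb.
pose CM := \matrix_(a, b) C a b.
have CU : forall k nu, Ck k (chart i0 @` U) (l nu).
  by move=> k nu; apply: Ck_subset imU _; exact: Cl.
pose la := local_form1 i0 l.
have la_form : form1 U la := local_form1_form1 oU U0 CU.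
have CeE k x : \sum_b CM b k *: e b x = \sum_a (\sum_b gM a b x * C b k) *: s a x.
  under eq_bigr do rewrite scaler_sumr; rewrite exchange_big; apply: eq_bigr => a _ /=.
  by rewrite scaler_suml; apply: eq_bigr => b _; rewrite mxE scalerA mulrC.
(* The solution of [local_gauge] gives this in the chart [i0]; both sides are components of 1-forms,
   so the same Jacobian takes them to the chart [i]. *)
have De k i mu x : U x -> chart_dom i x ->
    D (e k) i mu x = (la i mu x)%:A *: \sum_b CM b k *: e b x.
  move=> Ux ix; have i0x := U0 x Ux.
  have De0 nu : D (e k) i0 nu x = (l nu (chart i0 x))%:A *: \sum_b CM b k *: e b x.
    rewrite (@nabla_frame U (fun a => gM a k)) // CeE scaler_sumr.
    apply: eq_bigr => a _; rewrite scalerA mulr_algl; congr (_ *: _).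
    rewrite -(dg nu a k _ (Ut x Ux)) pderivE; congr (_ + _).
      apply: (eq_vderive _ oU'); first by exists x.
      by move=> y /(chart_imageP U0)[_ /= yE]; rewrite /gM yE.
    by apply: eq_bigr => b _; rewrite /= chartK.
  have [_ tr] := nabla_form1 D oU (e_smooth k).
  rewrite (tr i i0 mu x Ux ix i0x) /la /local_form1 !scaler_suml.
  by apply: eq_bigr => nu _; rewrite De0 scalerA mulr_algl scalerA.
exists U; split=> //.
  by split=> //; split; [exact: W0|exact: ballxx].
exists e, CM, la; split=> //.
- split=> // x Ux; have Wx := UW x Ux.
  have := frame_change (s_basis Wx) (dG _ (Ut x Ux)); congr (is_true (basis_of _ _)).
  congr val; apply: eq_mktuple => k; rewrite /e /gM.
  by under eq_bigr do rewrite mxE.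
- move=> x Ux k; have Wx := UW x Ux; rewrite CeE /e linear_sum /=.
  under eq_bigr do rewrite linearZ /= (PhisE _ Wx) scaler_sumr.
  rewrite exchange_big; apply: eq_bigr => a _ /=.
  (* The matrix identity [phi g = g C] says exactly that [Phi] has the constant matrix [C] in the
     frame [e]. *)
  rewrite -(pg a k _ (Ut x Ux)) scaler_suml. apply: eq_bigr => b _.
  by rewrite scalerA mulrC /= chartK //; exact: W0.
- apply: (ext_deriv_local_form1 oU U0 CU omega_form) => mu nu x Ux.
  by rewrite dl /= ?chartK //; [exact: U0|exact: Ut].
- move=> V f oV VU sf i mu x Vx ix; have Ux := VU x Vx.
  have sV k : smooth_section V (e k) by exact: smooth_section_subset VU (e_smooth k).
  rewrite (nabla_comb D _ mu oV sf sV Vx ix) big_split /=.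
  under [RHS]eq_bigr do rewrite scalerDl; rewrite [RHS]big_split /=; congr (_ + _).
  under eq_bigr do rewrite (De _ _ _ _ Ux ix) !scaler_sumr.
  rewrite exchange_big; apply: eq_bigr => b _ /=.
  move: ((la i mu x)%:A) => z; rewrite mulr_sumr scaler_suml; apply: eq_bigr => k _.
  by rewrite !scalerA; congr (_ *: _); ring.
Qed.

End FlatFrame.

Theorem proposition3p5 (R : realType) (K : fieldExtType R) (n r : nat)
    (M : manifold R (2 * n)) (omega : components2 M) (E : bundle K M r)
    (D : connection E) (Phi : endomorphism E) :
  symplectic omega ->
  symplectically_flat omega D Phi ->
  forall p : M, exists U : set M,
    [/\ open U, U p &
      exists (e : 'I_r -> section E) (C : 'M[K]_r) (lambda : components1 M),
        [/\ local_frame U e,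
            represented_by U e Phi C,
            form1 U lambda,
            forall i mu nu x, U x -> chart_dom i x ->
              ext_deriv1 lambda i mu nu x = omega i mu nu x &
            nabla_in_frame U e D C lambda]].
Proof.
move=> [omega_form omega_closed _] flat p.
have [i0 i0p] := chart_dom_cover p; have [a0 a0p] := triv_dom_cover E p.
exact: (flat_frame (i0 := i0) (a0 := a0) omega_form omega_closed flat (conj i0p a0p)).
Qed.
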